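(* Let $F(x),G(x)\in\mathcal O[x]$ be monic separable polynomials of degree $n$ such that $F\equiv G\pmod{\mathfrak m^\nu}$ for a positive integer $\nu>2\delta(F)/n$, where $\delta(F)=v(\operatorname{Disc}(F))$. Then $F$ is irreducible in $\mathcal O[x]$ if and only if $G$ is irreducible in $\mathcal O[x]$. If this is the case, the extensions of $k$ determined by $F$ and $G$ (that is, $k[x]/(F)$ and $k[x]/(G)$) have isomorphic maximal tamely ramified subextensions.
   Context: $k$ is a field that is complete and locally compact with respect to a discrete valuation $v$ normalized by $v(k^* )=\mathbb Z$, with valuation ring $\mathcal O$ and maximal ideal $\mathfrak m$. Congruences of polynomials are coefficientwise. *)

(* Defs.v *)
From HB Require Import structures.
From mathcomp Require Import all_boot all_order all_algebra all_field.
From mathcomp Require Import boolp classical_sets filter topology.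

Set Implicit Arguments.
Unset Strict Implicit.
Unset Printing Implicit Defensive.

Import Order.TTheory GRing.Theory Num.Theory.
Local Open Scope ring_scope.
Local Open Scope quotient_scope.

(* The value at 0 (mathematically +oo) is left unspecified; every use of a    *)
(* valuation below is guarded against it.                                     *)
Record discrete_valuation (k : fieldType) := DiscreteValuation {
  dval :> k -> int;
  dvalM : forall x y, x != 0 -> y != 0 -> dval (x * y) = dval x + dval y;
  dvalD : forall x y, x != 0 -> y != 0 -> x + y != 0 ->
    Num.min (dval x) (dval y) <= dval (x + y);
  dval_surj : forall m : int, exists2 x, x != 0 & dval x = m }.

(* The fractional ideal {x | v x >= m}: O for m = 0, and the m-th power of    *)
(* the maximal ideal for m > 0.                                               *)
Definition vge (k : fieldType) (v : discrete_valuation k) (m : int) :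
  {pred k} := fun x => (x == 0) || (m <= v x).

Section ValuationTheory.
Variables (k : fieldType) (v : discrete_valuation k).
Implicit Types (x y : k) (m : int).

Lemma vgeE m x : (x \in vge v m) = (x == 0) || (m <= v x).
Proof. by []. Qed.

Lemma vge0 m : 0 \in vge v m.
Proof. by rewrite vgeE eqxx. Qed.

Lemma vge_le m m' x : m <= m' -> x \in vge v m' -> x \in vge v m.
Proof.
by move=> mm'; rewrite !vgeE => /orP[->//|/(le_trans mm')->]; rewrite orbT.
Qed.

Lemma dval1 : v 1 = 0.
Proof.
have := dvalM v (oner_neq0 k) (oner_neq0 k); rewrite mulr1 => /eqP.
by rewrite -subr_eq0 opprD addrA subrr sub0r oppr_eq0 => /eqP.
Qed.

Lemma vge1 : 1 \in vge v 0.
Proof. by rewrite vgeE dval1 lexx orbT. Qed.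

Lemma vgeM m m' x y :
  x \in vge v m -> y \in vge v m' -> x * y \in vge v (m + m').
Proof.
rewrite !vgeE; have [->|x0] := eqVneq x 0; first by rewrite mul0r eqxx.
have [->|y0] := eqVneq y 0; first by rewrite mulr0 eqxx.
by move=> /= mx my; rewrite dvalM// lerD// orbT.
Qed.

Lemma dvalN1 : v (- 1) = 0.
Proof.
have N0 : - 1 != 0 :> k by rewrite oppr_eq0 oner_eq0.
have := dvalM v N0 N0; rewrite mulrNN mulr1 dval1 => /esym/eqP.
by rewrite -mulr2n mulrn_eq0 => /eqP.
Qed.

Lemma vgeN m x : x \in vge v m -> - x \in vge v m.
Proof.
move=> mx; rewrite -mulN1r -[m]add0r vgeM//.
by rewrite vgeE dvalN1 lexx orbT.
Qed.

Lemma vgeD m x y : x \in vge v m -> y \in vge v m -> x + y \in vge v m.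
Proof.
rewrite !vgeE; have [->|x0] := eqVneq x 0; first by rewrite add0r.
have [->|y0] := eqVneq y 0; first by rewrite addr0 (negPf x0).
have [//|xy0] := eqVneq (x + y) 0.
move=> /= mx my; apply: le_trans (dvalD v x0 y0 xy0).
by rewrite le_min mx.
Qed.

Lemma vgeB m x y : x \in vge v m -> y \in vge v m -> x - y \in vge v m.
Proof. by move=> mx my; apply: vgeD => //; apply: vgeN. Qed.

Lemma vge_subring : subring_closed (vge v 0).
Proof.
split; [exact: vge1 | by move=> x y; apply: vgeB |].
by move=> x y vx vy; rewrite -[0]addr0 vgeM.
Qed.

Lemma dvalV x : x != 0 -> v x^-1 = - v x.
Proof.
move=> x0; have := dvalM v x0 (invr_neq0 x0); rewrite divff// dval1 => /esym/eqP.
by rewrite addrC addr_eq0 => /eqP.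
Qed.

End ValuationTheory.

HB.instance Definition _ (k : fieldType) (v : discrete_valuation k) :=
  GRing.isSubringClosed.Build k (vge v 0) (vge_subring v).

Section ValuationTopology.
Variables (k : fieldType) (v : discrete_valuation k).

(* k with the uniformity, hence the topology, defined by v. *)
Definition vtop : Type := k.

HB.instance Definition _ := Choice.on vtop.
HB.instance Definition _ := isPointed.Build vtop (0 : k).

Definition vtop_entourage : set_system (vtop * vtop) :=
  filter_from setT
    (fun m : int => [set xy : vtop * vtop | (xy.1 : k) - xy.2 \in vge v m]%classic).

Fact vtop_entourage_filter : Filter vtop_entourage.
Proof.
apply: filter_from_filter; first by exists 0.
move=> m m' _ _; exists (Num.max m m') => // xy /= xy_ge.
by split; apply: vge_le xy_ge; rewrite le_max lexx ?orbT.
Qed.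

Fact vtop_entourage_diagonal A :
  vtop_entourage A -> (diagonal `<=` A)%classic.
Proof.
move=> [m _ mA] [x y] /= xy; apply: mA => /=.
by move: xy; rewrite /diagonal/= => ->; rewrite subrr vge0.
Qed.

Fact vtop_entourage_inv A :
  vtop_entourage A -> vtop_entourage (A^-1)%relation.
Proof.
move=> [m _ mA]; exists m => // -[x y] /= xy; apply: mA => /=.
by rewrite -opprB vgeN.
Qed.

Fact vtop_entourage_split A : vtop_entourage A ->
  exists2 B, vtop_entourage B & ((B \; B)%relation `<=` A)%classic.
Proof.
move=> [m _ mA]; exists [set xy : vtop * vtop | (xy.1 : k) - xy.2 \in vge v m]%classic.
  by exists m.
move=> [x y] [z /= xz zy]; apply: mA => /=.
by rewrite -(subrKA z) vgeD.
Qed.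

HB.instance Definition _ := isUniform.Build vtop vtop_entourage_filter
  vtop_entourage_diagonal vtop_entourage_inv vtop_entourage_split.

Definition v_complete : Prop :=
  forall A : set_system vtop, ProperFilter A -> cauchy A -> cvg A.

Definition v_locally_compact : Prop := locally_compact [set: vtop]%classic.

End ValuationTopology.

Section ValuationRing.
Variables (k : fieldType) (v : discrete_valuation k).

Record valuation_ring : Type :=
  ValuationRing { vr_val : k; vr_valP : vr_val \in vge v 0 }.

HB.instance Definition _ := [isSub for vr_val].
HB.instance Definition _ := [Choice of valuation_ring by <:].
HB.instance Definition _ := [SubChoice_isSubComNzRing of valuation_ring by <:].

Implicit Type x y : valuation_ring.

Definition vr_unit : {pred valuation_ring} :=
  fun x => (val x != 0) && (v (val x) == 0).

Definition vr_inv x : valuation_ring :=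
  if x \in vr_unit then insubd x (val x)^-1 else x.

Fact vr_mulV : {in vr_unit, left_inverse 1 vr_inv *%R}.
Proof.
move=> x ux; apply: val_inj; rewrite /vr_inv ux rmorphM rmorph1/=.
move: ux => /andP[x0 /eqP vx]; rewrite insubdK ?mulVf//.
by rewrite vgeE dvalV// vx oppr0 lexx orbT.
Qed.

Fact vr_unitPl x y : y * x = 1 -> vr_unit x.
Proof.
move=> /(congr1 val); rewrite rmorphM rmorph1 /= => yx1.
have : val y * val x != 0 by rewrite yx1 oner_eq0.
rewrite mulf_eq0 negb_or => /andP[y0 x0].
have := dvalM v y0 x0; rewrite yx1 dval1 /vr_unit x0/= => vxy.
have := valP y; have := valP x; rewrite !vgeE (negPf x0) (negPf y0)/= => vx vy.
by rewrite eq_le vx andbT; rewrite vxy lerDr.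
Qed.

Fact vr_inv_out : {in [predC vr_unit], vr_inv =1 id}.
Proof. by move=> x; rewrite inE /vr_inv => /negPf->. Qed.

HB.instance Definition _ := GRing.ComNzRing_hasMulInverse.Build valuation_ring
  vr_mulV vr_unitPl vr_inv_out.

Fact vr_integral : GRing.integral_domain_axiom valuation_ring.
Proof.
move=> x y /(congr1 val)/eqP; rewrite rmorphM rmorph0 mulf_eq0.
by rewrite -!(inj_eq val_inj).
Qed.

HB.instance Definition _ :=
  GRing.ComUnitRing_isIntegral.Build valuation_ring vr_integral.

Definition maximal_ideal : {pred valuation_ring} := fun x => val x \in vge v 1.

Lemma maximal_idealE x : (x \in maximal_ideal) = (val x \in vge v 1).
Proof. by []. Qed.

Lemma vr_unitE x : (x \is a GRing.unit) = (x \notin maximal_ideal).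
Proof.
rewrite maximal_idealE vgeE negb_or -ltNge.
rewrite -[LHS]/((val x != 0) && (v (val x) == 0)).
have [//|x0] := eqVneq (val x) 0; have := valP x.
by rewrite vgeE (negPf x0)/= eq_le => ->; rewrite andbT -[1]add0r ltzD1.
Qed.

Fact maximal_ideal_idealr : idealr_closed maximal_ideal.
Proof.
split; first by rewrite maximal_idealE rmorph0 vge0.
  by rewrite -vr_unitE unitr1.
move=> a x y; rewrite !maximal_idealE => mx my; rewrite rmorphD rmorphM vgeD//.
by rewrite -[1]add0r vgeM ?(valP a).
Qed.

HB.instance Definition _ :=
  isIdealr.Build valuation_ring maximal_ideal maximal_ideal_idealr.

Definition residue_field : Type := {ideal_quot maximal_ideal}.

HB.instance Definition _ := GRing.ComNzRing.on residue_field.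

Definition residue (x : valuation_ring) : residue_field :=
  \pi_{ideal_quot maximal_ideal} x.

Definition residue_lift (a : residue_field) : valuation_ring :=
  repr (a : {ideal_quot maximal_ideal}).

Lemma residue_liftK : cancel residue_lift residue.
Proof. by move=> a; apply: reprK. Qed.

Fact residue_zmod_morphism : zmod_morphism residue.
Proof. by move=> x y; rewrite /residue rmorphB. Qed.

Fact residue_monoid_morphism : monoid_morphism residue.
Proof. by split; [exact: rmorph1 | move=> x y; exact: rmorphM]. Qed.

HB.instance Definition _ := GRing.isZmodMorphism.Build
  valuation_ring residue_field residue residue_zmod_morphism.
HB.instance Definition _ := GRing.isMonoidMorphism.Build
  valuation_ring residue_field residue residue_monoid_morphism.

Lemma residue_eq0 x : (residue x == 0) = (x \in maximal_ideal).
Proof.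
rewrite -[0](rmorph0 residue) /residue -(subr0 x) Quotient.idealrBE subr0.
by [].
Qed.

Definition residue_inv (a : residue_field) : residue_field :=
  residue (residue_lift a)^-1 *+ (a != 0).

Fact residue_mulVf a : a != 0 -> residue_inv a * a = 1.
Proof.
move=> a0; rewrite /residue_inv a0 mulr1n -{2}(residue_liftK a) -rmorphM.
by rewrite mulVr ?rmorph1// vr_unitE -residue_eq0 residue_liftK.
Qed.

Fact residue_inv0 : residue_inv 0 = 0.
Proof. by rewrite /residue_inv eqxx. Qed.

HB.instance Definition _ :=
  GRing.ComNzRing_isField.Build residue_field residue_mulVf residue_inv0.

End ValuationRing.

Definition irreducible_elt (R : idomainType) (a : R) : Prop :=
  [/\ a != 0, a \isn't a GRing.unit &
      forall b c, a = b * c -> b \is a GRing.unit \/ c \is a GRing.unit].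

(* For monic p of degree n with roots a_i this is                             *)
(*   (-1)^(n(n-1)/2) \prod_i p'(a_i) = \prod_(i < j) (a_i - a_j)^2,           *)
(* also when p' has degree less than n - 1. In the row and column order of    *)
(* Sylvester_mx, resultant q p = \prod_i q(a_i) for p monic, whence the order *)
(* of the arguments.                                                          *)
Definition Disc (R : nzRingType) (p : {poly R}) : R :=
  (-1) ^+ 'C((size p).-1, 2) * resultant p^`() p.

Section IntegralPolynomials.
Variables (k : fieldType) (v : discrete_valuation k).
Implicit Types p q : {poly valuation_ring v}.

Definition poly_over_field p : {poly k} := map_poly val p.

Definition delta p : int := v (val (Disc p)).

Definition poly_congr_mod (nu : nat) p q : Prop :=
  forall i, val (p`_i - q`_i) \in vge v nu%:Z.

End IntegralPolynomials.

Section Ramification.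
Variables (k : fieldType) (v : discrete_valuation k).
Variables (K : fieldExtType k) (w : discrete_valuation K).

(* w, normalized by w(K^* ) = Z, restricts to e * v on k. *)
Definition ramification_index (e : nat) : Prop :=
  (0 < e)%N /\ forall x : k, x != 0 -> w (x%:A) = e%:Z * v x.

(* The default value 0 of insubd is not used when w extends v: see vr_inclE. *)
Definition vr_incl (x : valuation_ring v) : valuation_ring w :=
  insubd 0 (val x)%:A.

Lemma vr_inclE e x : ramification_index e -> val (vr_incl x) = (val x)%:A.
Proof.
move=> [_ we]; rewrite insubdK// vgeE scaler_eq0 oner_eq0 orbF.
have := valP x; rewrite vgeE; have [//|x0 /= vx] := eqVneq (val x) 0.
by rewrite we// mulr_ge0.
Qed.

Definition residue_incl (a : residue_field v) : residue_field w :=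
  residue (vr_incl (residue_lift a)).

Definition residue_separable : Prop :=
  forall b : residue_field w, exists2 p : {poly residue_field v},
    separable_poly p & root (map_poly residue_incl p) b.

End Ramification.

Definition tamely_ramified (k : fieldType) (v : discrete_valuation k)
    (K : fieldExtType k) : Prop :=
  exists (w : discrete_valuation K) (e : nat),
    [/\ ramification_index v w e, residue_separable v w &
        forall p, p \in [pchar (residue_field v)] -> ~~ (p %| e)%N].

(* The maximal tamely ramified subextension of L / k is the composite of all  *)
(* its tamely ramified subextensions (Neukirch, Algebraic Number Theory,      *)
(* Chapter II, Definition 7.11).                                              *)
Definition maximal_tame_subextension (k : fieldType) (v : discrete_valuation k)
    (L : fieldExtType k) (T : {subfield L}) : Prop :=
  (forall E : {subfield L}, tamely_ramified v (subvs_of E) -> (E <= T)%VS) /\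
  (forall T' : {subfield L},
    (forall E : {subfield L}, tamely_ramified v (subvs_of E) -> (E <= T')%VS) ->
    (T <= T')%VS).

(* Main.v *)
Require Import Defs.
From HB Require Import structures.
From mathcomp Require Import all_boot all_order all_algebra all_field.
From mathcomp Require Import boolp classical_sets filter topology.
From mathcomp Require Import zify ring.

Set Implicit Arguments.
Unset Strict Implicit.
Unset Printing Implicit Defensive.

Import Order.TTheory GRing.Theory Num.Theory VectorInternalTheory.
Local Open Scope ring_scope.

(** The two stem fields turn out to be isomorphic, not only their maximal
    tamely ramified subextensions; everything else is transport of structure.

    Write f, g for F, G over k. Let P be a monic irreducible factor of f, of
    degree d, let a be the class of X in L = k[X]/(P), and let w be the
    normalized valuation of L, with w = e v on k and d = e f_0, where f_0 w is
    v composed with the norm. The discriminant of f is, up to sign, the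
    resultant of f' and f, which is the norm of f' from k[X]/(f) to k
    [resultant_poly_norm], hence the product of the norms from the k[X]/(P)
    over the irreducible factors [poly_norm_mul]. Its valuation delta is thus
    shared out among the factors, and some P gets at most its proportional
    share [small_norm_factor]: n v(N(f'(a))) <= d delta, which says that
    w(f'(a)) <= e delta / n. If f is irreducible then P = f will do.

    Now nu > 2 delta / n gives e nu > 2 w(f'(a)), and since g(a) = (g - f)(a)
    and g' = f' mod m^nu, this reads w(g(a)) > 2 w(g'(a)): Newton's method
    [newton_root] gives a root b of g in L, with w(b - a) > w(f'(a)). The
    situation is then symmetric in (f, a) and (g, b), and the iteration for f
    started at b never leaves k(b), so f has a root in k(b) [stem_roots].
    - If f is irreducible, P = f, then k(b) has degree at least n over k, so it
      is L, and g, having degree n, is the minimal polynomial of b. Hence g is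
      irreducible and k[X]/(g) is isomorphic to k[X]/(f).
    - If g is irreducible, then n = [k(b) : k] <= [L : k] = d, so P = f.

    The valuation w comes from the norm [extend_valuation]. Only the
    ultrametric inequality for v o N is not formal. Let u(x) be the least
    valuation of a coordinate of x in a fixed basis. Compactness of the
    valuation ring bounds x^-1 in terms of u(x) [lattice_inv_bound], so that
    v(N(x)) and [L : k] u(x) differ by a bounded amount; applied to all the
    powers of 1 + t, this forces v(N(1 + t)) >= 0 as soon as v(N(t)) >= 0. The
    same compactness provides the limits in Newton's method. *)

(** * Estimates for a discrete valuation *)

Section ValuationFacts.
Variables (k : fieldType) (v : discrete_valuation k).
Implicit Types (x y : k) (m : int).

Lemma vgeN0 m x : x != 0 -> (x \in vge v m) = (m <= v x).
Proof. by move=> x0; rewrite vgeE (negPf x0). Qed.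

Lemma vge_opp m x : (- x \in vge v m) = (x \in vge v m).
Proof. by apply/idP/idP => /vgeN; rewrite ?opprK. Qed.

Lemma vge_sum I (r : seq I) (P : pred I) (f : I -> k) m :
  (forall i, P i -> f i \in vge v m) -> \sum_(i <- r | P i) f i \in vge v m.
Proof. by move=> fm; elim/big_ind: _ => // [|x y]; [apply: vge0|apply: vgeD]. Qed.

Lemma vge_prod n (f : 'I_n -> k) m :
  (forall i, f i \in vge v m) -> \prod_i f i \in vge v (n%:Z * m).
Proof.
elim: n f => [|n IHn] f fm; first by rewrite big_ord0 mul0r vge1.
by rewrite big_ord_recl intS mulrDl mul1r vgeM// IHn.
Qed.

Lemma vge_det n (A : 'M[k]_n) m :
  (forall i j, A i j \in vge v m) -> \det A \in vge v (n%:Z * m).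
Proof.
move=> Am; apply: vge_sum => s _; rewrite -[_ * m]add0r vgeM ?vge_prod//.
by rewrite rpredX// vgeN// vge1.
Qed.

Lemma vge_lower_bound (I : finType) (f : I -> k) :
  exists C : nat, forall i, f i \in vge v (- C%:Z).
Proof.
exists (\sum_i absz (v (f i)))%N => i; rewrite vgeE (bigD1 i)//=; apply/orP; right.
lia.
Qed.

Lemma vge_all_eq0 x : (forall m, x \in vge v m) -> x = 0.
Proof.
move=> xm; apply/eqP; have := xm (v x + 1); rewrite vgeE.
by case: eqP => //= _; lia.
Qed.

Lemma vge_natmul m x j : x \in vge v m -> x *+ j \in vge v m.
Proof. by move=> xm; elim: j => [|j IHj]; rewrite ?mulr0n ?vge0// mulrS vgeD. Qed.

Lemma dvalX x j : x != 0 -> v (x ^+ j) = v x * j%:Z.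
Proof.
move=> x0; elim: j => [|j IHj]; first by rewrite expr0 mulr0 dval1.
by rewrite exprS dvalM ?expf_neq0// IHj intS mulrDr mulr1.
Qed.

Lemma dval_addl m x y : x != 0 -> v x = m -> y \in vge v (m + 1) ->
  x + y != 0 /\ v (x + y) = m.
Proof.
move=> x0 vx ym.
have xy0 : x + y != 0.
  apply: contraTneq ym => /eqP; rewrite addr_eq0 => /eqP xE.
  by rewrite -vge_opp -xE vgeN0// vx; lia.
split=> //; apply/eqP; rewrite eq_le; apply/andP; split.
  rewrite leNgt; apply/negP => lt.
  have : x \in vge v (m + 1).
    by rewrite -(addrK y x) vgeB// vgeN0// lezD1.
  by rewrite vgeN0// vx; lia.
have : x + y \in vge v m.
  by apply: vgeD; [rewrite vgeN0 ?vx | apply: vge_le ym; lia].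
by rewrite vgeN0.
Qed.

End ValuationFacts.

(** * Sequential compactness of the valuation ring *)

(** The uniform space attached to v: its carrier is k, from which v cannot be
    recovered, so the instance has to be named. *)
Local Notation valued_space v := (Defs_vtop__canonical__uniform_structure_Uniform v).

Lemma vtop_nbhsP (k : fieldType) (v : discrete_valuation k) (x : valued_space v)
    (A : set (valued_space v)) :
  nbhs x A <-> exists m : int, forall y : k, (x : k) - y \in vge v m -> A y.
Proof.
rewrite -nbhs_entourageE /nbhs_/= ; split.
  case=> B [m _ mB] BA; exists m => y xy.
  by apply/BA; rewrite /xsection/= inE; apply: mB.
case=> m mA; exists [set xy : valued_space v * valued_space v |
  (xy.1 : k) - xy.2 \in vge v m]%classic.
  by exists m.
by move=> y /=; rewrite /xsection /= inE /= => /mA.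
Qed.

(** Some ball around 0 is compact, and every ball is a dilation of it. The
    cluster points of the coordinates are all taken along one ultrafilter
    finer than the filter of cofinite sets, so that a single index i serves
    for all the coordinates. *)
Lemma vge_sequentially_compact (k : fieldType) (v : discrete_valuation k)
    (n : nat) (r : nat -> 'rV[k]_n) :
  v_locally_compact v -> (forall i j, r i 0 j \in vge v 0) ->
  exists x : 'rV[k]_n, forall (m : int) (N : nat), exists2 i, (N <= i)%N &
    forall j, x 0 j - r i 0 j \in vge v m.
Proof.
move=> lc r0.
have [K] := lc 0 I.
rewrite withinET => /vtop_nbhsP[s sK] [cK _].
have [c c0 vc] := dval_surj v s.
have vcr i j : 0 - c * r i 0 j \in vge v s.
  by rewrite sub0r vgeN// -[s]addr0 vgeM// vgeE vc lexx orbT.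
have [U [UU oU]] := ultraFilterLemma (eventually_filter).
(* multiplication by c maps the valuation ring into the compact set K *)
have cvU j : exists y : k, forall m, U [set i | y - r i 0 j \in vge v m]%classic.
  have [|p [_ clp]] := cK _ (fmap_proper_filter
    (fun i => c * r i 0 j : valued_space v) (ultra_proper (F := U))).
    by rewrite /fmap/=; apply: filterS (filterT) => i _ /=; apply: sK.
  exists (p / c) => m.
  (* otherwise the complement is in U, and it avoids a neighbourhood of p *)
  have [//|Um] := in_ultra_setVsetC [set i | p / c - r i 0 j \in vge v m]%classic UU.
  have [||z [/= zP zm]] := clp
    [set y : valued_space v | ~ (p : k) - y \in vge v (m + s)]%classic
    [set y : valued_space v | (p : k) - y \in vge v (m + s)]%classic.
  - rewrite /fmap/=; apply: filterS Um => i /= nm; contradict nm.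
    have -> : p / c - r i 0 j = (p - c * r i 0 j) / c.
      by rewrite mulrBl mulrAC divff// mul1r.
    rewrite -[m](addrK s) vgeM// vgeE dvalV// vc lexx orbT//.
  - by apply/vtop_nbhsP; exists (m + s).
  by [].
have /choice[y yP] := cvU; exists (\row_j y j) => m N.
have : U ([set i | forall j, y j - r i 0 j \in vge v m] `&`
          [set i | (N <= i)%N])%classic.
  apply: filterI; last by apply: oU; exists N.
  by apply: filter_forall => j; apply: yP.
by move=> /filter_ex[i [/= iy Ni]]; exists i => // j; rewrite mxE.
Qed.

(** * The norm of a finite extension, and coordinates *)

Section RegularNorm.
Variables (k : fieldType) (L : fieldExtType k).
Implicit Types x y : L.

(** The regular representation of L over k. *)
Definition regmx x : 'M[k]_(dim L) := lin1_mx (v2r \o x \o* r2v).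

Definition reg_norm x : k := \det (regmx x).

Lemma v2rM x y : v2r (x * y) = v2r x *m regmx y.
Proof. by rewrite mul_rV_lin1 /= v2rK. Qed.

Lemma regmxP (A : 'M[k]_(dim L)) y :
  (forall x, v2r (x * y) = v2r x *m A) -> regmx y = A.
Proof.
by move=> yA; apply/row_matrixP => i; rewrite !rowE -[delta_mx _ _]r2vK -v2rM yA.
Qed.

Lemma regmxM x y : regmx (x * y) = regmx x *m regmx y.
Proof. by apply: regmxP => z; rewrite mulrA !v2rM mulmxA. Qed.

Lemma regmx_linear : linear regmx.
Proof.
move=> c x y; apply: regmxP => z.
by rewrite mulrDr -scalerAr linearD linearZ /= !v2rM mulmxDr scalemxAr.
Qed.

Lemma regmx_scalar c : regmx c%:A = c%:M.
Proof. by apply: regmxP => z; rewrite -scalerAr mulr1 linearZ mul_mx_scalar. Qed.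

HB.instance Definition _ := GRing.isLinear.Build k L 'M[k]_(dim L) _ regmx
  regmx_linear.

Lemma reg_normM x y : reg_norm (x * y) = reg_norm x * reg_norm y.
Proof. by rewrite /reg_norm regmxM det_mulmx. Qed.

Lemma reg_normA c : reg_norm c%:A = c ^+ dim L.
Proof. by rewrite /reg_norm regmx_scalar det_scalar. Qed.

Lemma reg_norm_neq0 x : x != 0 -> reg_norm x != 0.
Proof.
move=> x0; have := reg_normA 1; rewrite scale1r -(divff x0) reg_normM expr1n.
by apply: contra_eq_neq => ->; rewrite mul0r eq_sym oner_eq0.
Qed.

End RegularNorm.

Section Lattice.
Variables (k : fieldType) (v : discrete_valuation k) (L : fieldExtType k).
Implicit Types (x y : L) (m s : int).

(** These lattices are multiplicative only up to a bounded loss [latticeM_bound],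
    so that orders with respect to them determine a valuation only up to a
    bounded error; passing to high powers removes the error. *)
Definition lattice s : {pred L} := fun x => [forall j, v2r x 0 j \in vge v s].

Lemma latticeP s x : reflect (forall j, v2r x 0 j \in vge v s) (x \in lattice s).
Proof. exact: forallP. Qed.

Lemma lattice_le s s' x : s <= s' -> x \in lattice s' -> x \in lattice s.
Proof. by move=> ss' /latticeP xs; apply/latticeP => j; apply: vge_le (xs j). Qed.

Lemma lattice0 s : 0 \in lattice s.
Proof. by apply/latticeP => j; rewrite linear0 mxE vge0. Qed.

Lemma latticeD s x y : x \in lattice s -> y \in lattice s -> x + y \in lattice s.
Proof.
by move=> /latticeP xs /latticeP ys; apply/latticeP => j; rewrite linearD mxE vgeD.
Qed.

Lemma latticeZ s s' c x : c \in vge v s' -> x \in lattice s ->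
  c *: x \in lattice (s' + s).
Proof.
by move=> cs /latticeP xs; apply/latticeP => j; rewrite linearZ mxE vgeM.
Qed.

Lemma latticeN s x : (- x \in lattice s) = (x \in lattice s).
Proof. by apply: eq_forallb => j; rewrite linearN mxE vge_opp. Qed.

Lemma lattice_natmul s x j : x \in lattice s -> x *+ j \in lattice s.
Proof.
by move=> /latticeP xs; apply/latticeP => i; rewrite linearMn mulmxnE vge_natmul.
Qed.

Lemma lattice_lower_bound x : exists C : nat, x \in lattice (- C%:Z).
Proof. by have [C xC] := vge_lower_bound v (v2r x 0); exists C; apply/latticeP. Qed.

Lemma lattice_order x : x != 0 ->
  exists2 s, x \in lattice s & x \notin lattice (s + 1).
Proof.
move=> x0; have : exists j, v2r x 0 j != 0.
  apply/existsP; apply: contraNT x0 => /existsPn x0.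
  rewrite -(inj_eq (can_inj v2rK)) linear0; apply/eqP/rowP => j.
  by rewrite mxE; apply/eqP; rewrite -[_ == _]negbK x0.
case=> j0 xj0.
have [j xj jmin] := @arg_minP _ _ _ j0 (fun j => v2r x 0 j != 0)
  (fun j => v (v2r x 0 j)) xj0.
exists (v (v2r x 0 j)).
  apply/latticeP => i; rewrite vgeE; case: eqVneq => //= xi; exact: jmin.
by apply/latticeP => /(_ j); rewrite vgeN0//; lia.
Qed.

Lemma lattice_all_eq0 x : (forall s, x \in lattice s) -> x = 0.
Proof.
move=> xs; apply/eqP; apply/negPn/negP => /lattice_order[s _ /negP]; exact.
Qed.

Lemma lattice_linear_bound (A : 'M[k]_(dim L)) : exists C : nat, forall s x y,
  x \in lattice s -> v2r y = v2r x *m A -> y \in lattice (s - C%:Z).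
Proof.
have [C AC] := vge_lower_bound v (fun ij => A ij.1 ij.2).
exists C => s x y /latticeP xs yE; apply/latticeP => j; rewrite yE mxE vge_sum// => i _.
by rewrite vgeM// (AC (i, j)).
Qed.

Lemma regmx_lower_bound : exists C : nat, forall s x i j,
  x \in lattice s -> regmx x i j \in vge v (s - C%:Z).
Proof.
have [C bC] := vge_lower_bound v
  (fun t : 'I_(dim L) * ('I_(dim L) * 'I_(dim L)) =>
     regmx (r2v (delta_mx 0 t.1) : L) t.2.1 t.2.2).
exists C => s x i j /latticeP xs.
rewrite -[x]v2rK [v2r x]row_sum_delta !linear_sum summxE vge_sum// => l _.
by rewrite !linearZ mxE vgeM// (bC (l, (i, j))).
Qed.

Lemma latticeM_bound : exists C : nat, forall s t x y,
  x \in lattice s -> y \in lattice t -> x * y \in lattice (s + t - C%:Z).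
Proof.
have [C bC] := regmx_lower_bound; exists C => s t x y /latticeP xs yt.
by apply/latticeP => j; rewrite v2rM mxE vge_sum// => i _; rewrite -addrA vgeM// bC.
Qed.

End Lattice.

(** * Extension of the valuation to a finite extension *)

Section InverseBound.
Variables (k : fieldType) (v : discrete_valuation k) (L : fieldExtType k).
Hypothesis lcv : v_locally_compact v.
Implicit Types (x y : L) (m s : int).
Local Notation lattice := (lattice v).

Lemma dval_scale t : exists2 c : k, c != 0 &
  forall x s, (c *: x \in lattice (t + s)) = (x \in lattice s).
Proof.
have [c c0 vc] := dval_surj v t; exists c => // x s; apply/idP/idP => [|xs].
  move=> /(latticeZ (s' := - t) (c := c^-1)).
  by rewrite scalerK// addKr; apply; rewrite vgeN0 ?invr_neq0// dvalV// vc.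
by apply: latticeZ; rewrite // vgeN0// vc.
Qed.

Lemma lattice_cluster (y : nat -> L) : (forall i, y i \in lattice 0) ->
  exists x, forall m N, exists2 i, (N <= i)%N & x - y i \in lattice m.
Proof.
move=> y0; have [|r rP] := vge_sequentially_compact (r := v2r \o y) lcv.
  by move=> i; apply/latticeP.
exists (r2v r) => m N; have [i Ni ri] := rP m N; exists i => //.
by apply/latticeP => j; rewrite linearB/= r2vK !mxE.
Qed.

(** Otherwise there are y_i of order 0 whose inverses have orders tending to
    minus infinity. Let x be a cluster point of the y_i; it is nonzero. Writing
    y_i^-1 = x^-1 (1 + (x - y_i) y_i^-1) with x - y_i small, the order of the
    right-hand side exceeds that of the left-hand side. *)
Lemma lattice_inv_bound : exists D : nat, forall s x, x != 0 ->
  x \notin lattice (s + 1) -> x^-1 \in lattice (- s - D%:Z).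
Proof.
apply: contrapT => noD.
have bad (D : nat) : exists y, [/\ y \in lattice 0, y \notin lattice 1
    & y^-1 \notin lattice (- D%:Z)].
  move: noD => /forallNP/(_ D)/existsNP[s /existsNP[x]].
  case/not_implyP => x0 /not_implyP[xs /negP xV].
  have [t xt xt1] := lattice_order v x0.
  have ts : t <= s.
    by rewrite leNgt; apply: contra xs => st; apply: lattice_le xt; lia.
  have [c c0 cP] := dval_scale (- t).
  exists (c *: x); split.
  - by have := cP x t; rewrite addNr => ->.
  - by have := cP x (t + 1); rewrite addKr => ->.
  rewrite -(cP _ (- D%:Z)); apply: contra xV; rewrite invrZ ?unitfE//.
  by rewrite scalerA divff// scale1r; apply: lattice_le; lia.
have /choice[y yP] := bad.
have [x xP] : exists x, forall m N, exists2 i, (N <= i)%N & x - y i \in lattice m.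
  by apply: lattice_cluster => i; case: (yP i).
have x0 : x != 0.
  apply/eqP => xE; have [i _] := xP 1 0%N; rewrite xE sub0r => yi.
  by have [_ /negP[]] := yP i; rewrite -latticeN.
have [e le] := lattice_lower_bound v (1 : L).
have [E lE] := lattice_lower_bound v x^-1.
have [C lC] := latticeM_bound v L.
(* C + C + E + 1 outweighs the losses in the two products below; the bound on i
   makes the term x^-1 * 1 negligible *)
have [i Ni xyi] := xP (C + C + E + 1)%N (E + e + C)%N.
have [yi0 yi1 yiV] := yP i.
have y0 : y i != 0 by apply: contraNneq yi1 => ->; rewrite lattice0.
have [s us us1] := lattice_order v (invr_neq0 y0).
have si : s < - i%:Z.
  by rewrite ltNge; apply: contra yiV => si; apply: lattice_le us.
have /negP[] := us1.
have -> : (y i)^-1 = x^-1 * (1 + (x - y i) * (y i)^-1).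
  by rewrite mulrBl divff// addrC subrK mulKf.
pose m : int := s + (C + E + 1)%N.
have := lC _ _ _ _ lE (_ : 1 + (x - y i) / y i \in lattice m).
move/(_ _)/(lattice_le _); apply.
  by rewrite /m; lia.
apply: latticeD; first by apply: lattice_le le; rewrite /m; lia.
by apply: lattice_le (lC _ _ _ _ xyi us); rewrite /m; lia.
Qed.

End InverseBound.

Section ExtendValuation.
Variables (k : fieldType) (v : discrete_valuation k) (L : fieldExtType k).
Hypothesis lcv : v_locally_compact v.
Implicit Types (x y : L) (m s : int).
Local Notation lattice := (lattice v).
Let n : nat := dim L.

Lemma fieldExt_dim_gt0 : (0 < n)%N.
Proof. by rewrite /n -dimvf (adim_gt0 {:L}%AS). Qed.

Let w0 x : int := v (reg_norm x).

Let w0M x y : x != 0 -> y != 0 -> w0 (x * y) = w0 x + w0 y.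
Proof. by move=> x0 y0; rewrite /w0 reg_normM dvalM ?reg_norm_neq0. Qed.

Let w01 : w0 1 = 0.
Proof. by rewrite /w0 -[1]scale1r reg_normA expr1n dval1. Qed.

Let w0A c : c != 0 -> w0 c%:A = n%:Z * v c.
Proof. by move=> c0; rewrite /w0 reg_normA dvalX// mulrC. Qed.

Let w0V x : x != 0 -> w0 x^-1 = - w0 x.
Proof.
by move=> x0; apply/eqP; rewrite -addr_eq0 addrC -w0M ?invr_neq0// divff// w01.
Qed.

Let w0X x j : x != 0 -> w0 (x ^+ j) = j%:Z * w0 x.
Proof.
move=> x0; elim: j => [|j IHj]; first by rewrite expr0 mul0r w01.
by rewrite exprS w0M ?expf_neq0// IHj intS mulrDl mul1r.
Qed.

(** The lower bound for v o N is that of a determinant with integral entries up to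
    scaling; the upper bound is the lower bound for x^-1 [lattice_inv_bound]. *)
Lemma reg_norm_lattice : exists K : nat, forall s x, x != 0 ->
  (x \in lattice s -> n%:Z * (s - K%:Z) <= v (reg_norm x)) /\
  (n%:Z * (s + K%:Z) <= v (reg_norm x) -> x \in lattice s).
Proof.
have [C lC] := regmx_lower_bound v L.
have [D lD] := lattice_inv_bound L lcv.
have up s x : x != 0 -> x \in lattice s -> n%:Z * (s - C%:Z) <= w0 x.
  move=> x0 xs; rewrite -(@vgeN0 _ v _ (reg_norm x)) ?reg_norm_neq0//.
  by apply: vge_det => i j; apply: lC.
have n0 := fieldExt_dim_gt0.
exists (C + D)%N => s x x0; split=> [/up|].
  by move/(_ x0); apply: le_trans; rewrite ler_pM2l//; lia.
rewrite -/(w0 x); apply: contraTT => xs.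
have := up _ _ (invr_neq0 x0) (lD (s - 1) x x0 _).
rewrite subrK => /(_ xs); rewrite w0V// -ltNge => le.
have : w0 x <= n%:Z * (s - 1 + D%:Z + C%:Z).
  by rewrite -lerN2 -mulrN; apply: le_trans le; rewrite ler_pM2l//; lia.
by move=> /le_lt_trans; apply; rewrite ltr_pM2l//; lia.
Qed.

(* All the powers of t, hence those of 1 + t by the binomial formula, lie in one
   lattice. So the multiples of w0 (1 + t) are bounded below. *)
Let w0_ultra1 t : t != 0 -> 1 + t != 0 -> 0 <= w0 t -> 0 <= w0 (1 + t).
Proof.
move=> t0 t1 wt; have n0 := fieldExt_dim_gt0.
have [K lK] := reg_norm_lattice.
have tX j : t ^+ j \in lattice (- K%:Z).
  have [_] := lK (- K%:Z) _ (expf_neq0 j t0); apply.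
  by rewrite addNr mulr0 -/(w0 _) w0X// mulr_ge0.
have bound j : n%:Z * (- K%:Z - K%:Z) <= j%:Z * w0 (1 + t).
  rewrite -w0X//; have [] := lK (- K%:Z) _ (expf_neq0 j t1); move=> lKj _; apply: lKj.
  rewrite addrC exprD1n.
  elim/big_ind: _ => [|? ?|i _]; [exact: lattice0|exact: latticeD|].
  exact: lattice_natmul.
rewrite leNgt; apply/negP => w1.
have := bound (n * (K + K) + 1)%N.
have : (n * (K + K) + 1)%N%:Z * w0 (1 + t) <= (n * (K + K) + 1)%N%:Z * (-1).
  by rewrite ler_pM2l//; lia.
lia.
Qed.

Lemma reg_norm_ultrametric x y : x != 0 -> y != 0 -> x + y != 0 ->
  Num.min (v (reg_norm x)) (v (reg_norm y)) <= v (reg_norm (x + y)).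
Proof.
have main a b : a != 0 -> b != 0 -> a + b != 0 -> w0 a <= w0 b ->
    w0 a <= w0 (a + b).
  move=> a0 b0 ab0 wab.
  have abE : a + b = a * (1 + b / a) by rewrite mulrDr mulr1 mulrC divfK.
  have := ab0; rewrite abE mulf_eq0 negb_or => /andP[_ ab1].
  rewrite w0M// lerDl w0_ultra1 ?mulf_neq0 ?invr_neq0//.
  by rewrite w0M ?invr_neq0// w0V// subr_ge0.
move=> x0 y0 xy0; rewrite -!/(w0 _) ge_min.
have [xy|/ltW yx] := leP (w0 x) (w0 y); first by rewrite main.
by rewrite orbC addrC main// addrC.
Qed.

Let w0_gcd : exists g : nat, [/\ (0 < g)%N, (exists2 x, x != 0 & w0 x = g%:Z) &
   forall x, x != 0 -> (g %| w0 x)%Z].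
Proof.
have n0 := fieldExt_dim_gt0.
have ex : exists g : nat, (0 < g)%N && `[< exists2 x, x != 0 & w0 x = g%:Z >].
  exists n; rewrite n0; apply/asboolP; have [c c0 vc] := dval_surj v 1.
  by exists c%:A; rewrite ?scaler_eq0 ?negb_or ?c0 ?oner_neq0// w0A// vc mulr1.
case: (ex_minnP ex) => g /andP[g0 /asboolP[a a0 wa]] gmin.
exists g; split=> //; first by exists a.
move=> x x0; apply/dvdz_mod0P; set r := (_ %% _)%Z.
have r0 : 0 <= r by rewrite modz_ge0// -lt0n.
have rg : r < g%:Z by rewrite ltz_pmod.
apply/eqP/negPn/negP => rn0.
have wr : exists2 z, z != 0 & w0 z = r.
  pose q := (w0 x %/ g)%Z.
  exists (x * a ^ (- q)); first by rewrite mulf_neq0// expfz_neq0.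
  have -> : r = w0 x - q * g%:Z by rewrite {1}(divz_eq (w0 x) g) addrC addKr.
  rewrite w0M ?expfz_neq0//; congr (_ + _).
  rewrite -wa -mulNr; case: (- q) => j; first by rewrite -exprnP w0X.
  by rewrite NegzE -exprnN w0V ?expf_neq0// w0X// mulNr.
case: wr => z z0 wz.
have := gmin (absz r); rewrite gtz0_abs ?lt_neqAle ?r0 ?andbT 1?eq_sym//.
have -> : (0 < `|r|)%N by rewrite absz_gt0.
rewrite /= => /(_ _)/wrap[]; last by lia.
by apply/asboolP; exists z; rewrite ?wz// gez0_abs.
Qed.

(** The normalized extension of v is v o N divided by the generator g of its
    group of values. The comparison with the lattices says that w defines the
    topology of coordinatewise convergence. *)
Theorem extend_valuation : exists (w : discrete_valuation L) (e g : nat),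
  [/\ ramification_index v w e, (e * g)%N = dim L,
      forall x, x != 0 -> v (reg_norm x) = g%:Z * w x &
      exists K : nat, forall s x,
        (x \in lattice s -> x \in vge w (e%:Z * s - K%:Z)) /\
        (x \in vge w (e%:Z * s + K%:Z) -> x \in lattice s)].
Proof.
have n0 := fieldExt_dim_gt0; have [g [g0 [a a0 wa] gP]] := w0_gcd.
have g0' : g%:Z != 0 by rewrite eqz_nat -lt0n.
pose w x := (w0 x %/ g)%Z.
have wE x : x != 0 -> w0 x = w x * g%:Z by move=> x0; rewrite divzK// gP.
have wM x y : x != 0 -> y != 0 -> w (x * y) = w x + w y.
  move=> x0 y0; apply: (mulIf g0').
  by rewrite mulrDl -!wE ?mulf_neq0// w0M.
have wD x y : x != 0 -> y != 0 -> x + y != 0 -> Num.min (w x) (w y) <= w (x + y).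
  move=> x0 y0 xy0; rewrite -(@ler_pM2r _ g%:Z)// minr_pMl// -!wE//.
  exact: reg_norm_ultrametric.
have w_surj m : exists2 x, x != 0 & w x = m.
  exists (a ^ m); rewrite ?expfz_neq0//; apply: (mulIf g0').
  rewrite -wE ?expfz_neq0// -wa mulrC; case: m => j.
    by rewrite -exprnP w0X// mulrC.
  by rewrite NegzE -exprnN w0V ?expf_neq0// w0X// mulrN mulrC.
have ng : (g %| n)%N.
  have [c c0 vc] := dval_surj v 1.
  have cA : c%:A != 0 :> L by rewrite scaler_eq0 negb_or c0 oner_neq0.
  by have := gP _ cA; rewrite w0A// vc mulr1 dvdzE.
pose W := DiscreteValuation wM wD w_surj.
pose e := (n %/ g)%N; have ne : n = (e * g)%N by rewrite divnK.
have e0 : (0 < e)%N by rewrite divn_gt0// dvdn_leq.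
exists W, e, g; split; rewrite -?ne//.
- split=> // c c0; apply: (mulIf g0').
  rewrite -wE ?scaler_eq0 ?negb_or ?c0 ?oner_neq0//.
  by rewrite w0A// ne PoszM mulrAC.
- by move=> x x0; rewrite mulrC -wE.
have [K lK] := reg_norm_lattice.
exists (e * K)%N => s x.
have [->|x0] := eqVneq x 0; first by rewrite vge0 lattice0.
have [l1 l2] := lK s x x0; rewrite !vgeN0//; split=> [/l1|xs]; last first.
  apply: l2; rewrite -/(w0 x) wE// ne PoszM mulrAC ler_pM2r//.
  by apply: le_trans xs; rewrite PoszM mulrDr.
rewrite -/(w0 x) wE// ne PoszM mulrAC ler_pM2r// => xs.
by apply: le_trans xs; rewrite PoszM mulrBr.
Qed.

End ExtendValuation.

(** The Bolzano-Weierstrass property of the integers of E; it yields limits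
    without a choice of subsequences. *)
Definition bolzano_weierstrass (L : fieldType) (w : discrete_valuation L)
    (E : {pred L}) :=
  forall y : nat -> L, (forall i, y i \in E) -> (forall i, y i \in vge w 0) ->
  exists2 x, x \in E & forall m N, exists2 i, (N <= i)%N & x - y i \in vge w m.

Section BolzanoWeierstrass.
Variables (k : fieldType) (v : discrete_valuation k) (L : fieldExtType k).
Hypothesis lcv : v_locally_compact v.
Variables (w : discrete_valuation L) (e K : nat).
Hypothesis e0 : (0 < e)%N.
Hypothesis lattice_vge : forall s x,
  (x \in lattice v s -> x \in vge w (e%:Z * s - K%:Z)) /\
  (x \in vge w (e%:Z * s + K%:Z) -> x \in lattice v s).

(** A subspace is closed, being the kernel of a projection, which is bounded with
    respect to the lattices. *)
Lemma subspace_bolzano_weierstrass (E : {vspace L}) : bolzano_weierstrass w E.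
Proof.
move=> y yE y0.
have yK i : y i \in lattice v (- K%:Z).
  by have [_] := lattice_vge (- K%:Z) (y i); apply; apply: vge_le (y0 i); nia.
have [c c0 cP] := dval_scale v L K%:Z.
have [i|x xP] := lattice_cluster lcv (y := fun i => c *: y i).
  by have := cP (y i) (- K%:Z); rewrite subrr => ->.
have xP' m N : exists2 i, (N <= i)%N & c^-1 *: x - y i \in lattice v m.
  have [i Ni xi] := xP (K%:Z + m) N; exists i => //.
  by rewrite -cP scalerBr scalerA divff// scale1r.
exists (c^-1 *: x); last first.
  move=> m N; have [i Ni xi] := xP' (absz m + K)%N N; exists i => //.
  have [l _] := lattice_vge (absz m + K)%N (c^-1 *: x - y i).
  by apply: vge_le (l xi); nia.
set z := c^-1 *: x in xP' *.
suff zE : z - projv E z = 0 by rewrite -(subrK (projv E z) z) zE add0r memv_proj.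
pose A := lin1_mx (v2r \o (\1 - projv E)%VF \o r2v).
have [C AC] := lattice_linear_bound v A.
apply: (lattice_all_eq0 (v := v)) => s.
have [i _ zi] := xP' (s + C%:Z) 0%N.
rewrite -(addrK C%:Z s); apply: AC zi _.
rewrite mul_rV_lin1 /= v2rK; congr v2r.
rewrite add_lfunE opp_lfunE id_lfunE linearB/= (projv_id (yE i)) opprB.
by rewrite addrA subrK.
Qed.

End BolzanoWeierstrass.

(** * Newton's method *)

Section Newton.
Variables (L : fieldType) (w : discrete_valuation L).
Implicit Types (x h : L) (m : int).

Lemma integral_taylor (g : {poly L}) x h :
  g \is a polyOver (vge w 0) -> x \in vge w 0 -> h \in vge w 0 ->
  exists2 r, r \in vge w 0 & g.[x + h] = g.[x] + g^`().[x] * h + r * h ^+ 2.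
Proof.
move=> gO xO hO.
rewrite (nderiv_taylor_wide (n := (size g).+2)) ?leqW//; last exact: mulrC.
rewrite !big_ord_recl/= expr0 mulr1 expr1 nderivn0 nderivn1 addrA.
pose r := \sum_(i < size g) g^`N(i.+2).[x] * h ^+ i.
exists r; last first.
  congr (_ + _); rewrite mulr_suml; apply: eq_bigr => i _.
  by rewrite -mulrA -exprD addn2.
apply: rpred_sum => i _.
by rewrite rpredM ?rpredX ?rpred_horner// polyOver_nderivn.
Qed.

Lemma integral_horner_diff (g : {poly L}) x y m :
    g \is a polyOver (vge w 0) -> x \in vge w 0 -> y \in vge w 0 ->
    x - y \in vge w m ->
  g.[x] - g.[y] \in vge w m.
Proof.
move=> gO xO yO xym.
have [r rO] := integral_taylor gO yO (rpredB xO yO).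
rewrite subrKC => ->.
have -> : g.[y] + g^`().[y] * (x - y) + r * (x - y) ^+ 2 - g.[y] =
  (g^`().[y] + r * (x - y)) * (x - y) by ring.
rewrite -[m]add0r vgeM// rpredD ?rpredM ?rpredB// rpred_horner//.
exact: polyOver_deriv.
Qed.

(** Hensel's lemma in Newton's form. A Newton step x - g(x) / g'(x) stays in E,
    stays close enough to a to keep the valuation d of g', and at least adds 1
    to the valuation of g(x). A cluster point of such improvements is a root;
    working with cluster points, one needs improvements of any given quality,
    but not that they form a Cauchy sequence. *)
Theorem newton_root (E : divringClosed L) (g : {poly L}) a (d := w g^`().[a]) :
    bolzano_weierstrass w E ->
    g \is a polyOver (vge w 0) -> g \is a polyOver E ->
    a \in vge w 0 -> a \in E ->
    g^`().[a] != 0 -> g.[a] \in vge w (2 * d + 1) ->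
  exists b, [/\ b \in E, root g b & b - a \in vge w (d + 1)].
Proof.
move=> cluster gO gE aO aE g'a0 ga.
have dE : w g^`().[a] = d by [].
clearbody d.
have g'O : g^`() \is a polyOver (vge w 0) by apply: polyOver_deriv.
have d0 : 0 <= d by have := rpred_horner g'O aO; rewrite vgeN0// dE.
have nearO x : x - a \in vge w (d + 1) -> x \in vge w 0.
  by move=> xa; rewrite -(subrK a x) vgeD//; apply: vge_le xa; lia.
have near_deriv x : x - a \in vge w (d + 1) -> g^`().[x] != 0 /\ w g^`().[x] = d.
  move=> xa; rewrite -(subrKC g^`().[a] g^`().[x]); apply: dval_addl => //.
  by apply: integral_horner_diff => //; apply: nearO.
have approx (i : nat) : exists x, [/\ x \in E, x - a \in vge w (d + 1) &
    g.[x] \in vge w (2 * d + 1 + i%:Z)].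
  elim: i => [|i [x [xE xa gx]]].
    by exists a; split; rewrite ?addr0// subrr vge0.
  have [g'x0 wg'x] := near_deriv x xa.
  pose h := - (g.[x] / g^`().[x]).
  have hw : h \in vge w (d + 1 + i%:Z).
    rewrite vgeN//; have -> : d + 1 + i%:Z = (2 * d + 1 + i%:Z) - d by clear -d0; lia.
    by rewrite vgeM// vgeN0 ?invr_neq0// dvalV// wg'x.
  have hE : h \in E.
    by rewrite rpredN rpred_div// rpred_horner// ?polyOver_deriv.
  have hO : h \in vge w 0 by apply: vge_le hw; clear -d0; lia.
  exists (x + h); split; first by rewrite rpredD.
    by rewrite [x + h]addrC -addrA; apply: vgeD => //; apply: vge_le hw; clear -d0; lia.
  have [r rO ->] := integral_taylor gO (nearO x xa) hO.
  rewrite mulrN mulrCA divff// mulr1 subrr add0r.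
  have := vgeM rO (vgeM hw hw); rewrite -expr2 add0r; apply: vge_le; clear -d0; lia.
have /choice[y yP] := approx.
have [||b bE bP] := cluster y; [by move=> i; case: (yP i) |
  by move=> i; case: (yP i) => _ /nearO |].
have ba : b - a \in vge w (d + 1).
  have [i _ byi] := bP (d + 1) 0%N; have [_ ya _] := yP i.
  by rewrite -(subrK (y i) b) -addrA; apply: vgeD.
exists b; split=> //; apply/eqP; apply: (vge_all_eq0 (v := w)) => m.
have [i mi byi] := bP m (absz m); have [_ ya gy] := yP i.
rewrite -(subrK g.[y i] g.[b]); apply: vgeD; last first.
  by apply: vge_le gy; clear -d0 mi; lia.
by apply: integral_horner_diff => //; apply: nearO.
Qed.

End Newton.

(** * Resultants as norms *)

Section PolyNorm.
Variable k : fieldType.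
Implicit Types p q r : {poly k}.

(** Remainder and quotient by p, in the form of functions of the dividend, to
    carry their linear structures. *)
Definition modp_by p r := r %% p.

Fact modp_by_linear p : linear (modp_by p).
Proof. by move=> c r s; rewrite /modp_by modpD modpZl. Qed.

HB.instance Definition _ p :=
  GRing.isLinear.Build k {poly k} {poly k} _ (modp_by p) (modp_by_linear p).

Definition divp_by p r := r %/ p.

Fact divp_by_linear p : linear (divp_by p).
Proof. by move=> c r s; rewrite /divp_by divpD divpZl. Qed.

HB.instance Definition _ p :=
  GRing.isLinear.Build k {poly k} {poly k} _ (divp_by p) (divp_by_linear p).

(** Multiplication by q on k[X]/(p), in the basis of the powers of X, for p of
    degree d. The degree is a separate argument so that the block decomposition
    for a product of polynomials needs no cast. *)
Definition mulmodmx d p q : 'M[k]_d :=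
  lin1_mx (poly_rV \o modp_by p \o q \o* rVpoly).

(** The norm of q from k[X]/(p), which need not be a field, to k. *)
Definition poly_norm d p q := \det (mulmodmx d p q).

Lemma mulmodmxE d p q (r : 'rV_d) : size p = d.+1 ->
  rVpoly (r *m mulmodmx d p q) = (rVpoly r * q) %% p.
Proof.
move=> sp; rewrite mul_rV_lin1 /= poly_rV_K//.
by rewrite -ltnS -sp ltn_modp -size_poly_gt0 sp.
Qed.

Lemma modp_mul_expand p1 p2 a : p1 != 0 -> p2 != 0 ->
  a %% (p1 * p2) = a %% p1 + p1 * ((a %/ p1) %% p2).
Proof.
move=> p10 p20; apply/esym/(modpP (q := (a %/ p1) %/ p2)).
  rewrite {1}(divp_eq a p1) {1}(divp_eq (a %/ p1) p2).
  by ring.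
have s1 : (size (a %% p1)%R < size p1)%N by rewrite ltn_modp.
have s2 : (size ((a %/ p1) %% p2)%R < size p2)%N by rewrite ltn_modp.
apply: leq_ltn_trans (size_polyD _ _) _.
rewrite gtn_max (leq_trans s1) ?dvdp_leq ?mulf_neq0 ?dvdp_mulr//=.
have [->|b0] := eqVneq (a %/ p1 %% p2) 0.
  by rewrite mulr0 size_poly0 size_poly_gt0 mulf_neq0.
by rewrite !size_mul// ltn_predRL prednK ?ltn_add2l// addn_gt0 size_poly_gt0 p10.
Qed.

(** In the basis formed by the powers X^i for i < d1 and the p1 X^j for j < d2,
    multiplication by q modulo p1 p2 is block triangular, because the multiples
    of p1 are stable. *)
Lemma poly_norm_mul d1 d2 p1 p2 q : size p1 = d1.+1 -> size p2 = d2.+1 ->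
  poly_norm (d1 + d2) (p1 * p2) q = poly_norm d1 p1 q * poly_norm d2 p2 q.
Proof.
move=> s1 s2; have p10 : p1 != 0 by rewrite -size_poly_gt0 s1.
have p20 : p2 != 0 by rewrite -size_poly_gt0 s2.
have s12 : size (p1 * p2) = (d1 + d2).+1 by rewrite size_mul// s1 s2 addSn addnS.
pose A : 'M[k]_(d1, d1 + d2) := lin1_mx (poly_rV \o rVpoly).
pose B : 'M[k]_(d2, d1 + d2) := lin1_mx (poly_rV \o p1 \o* rVpoly).
pose X : 'M[k]_(d1, d2) :=
  lin1_mx (poly_rV \o modp_by p2 \o divp_by p1 \o q \o* rVpoly).
have AE (r : 'rV_d1) : rVpoly (r *m A) = rVpoly r.
  by rewrite mul_rV_lin1 /= poly_rV_K// (leq_trans (size_poly _ _)) ?leq_addr.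
have BE (r : 'rV_d2) : rVpoly (r *m B) = rVpoly r * p1.
  rewrite mul_rV_lin1 /= poly_rV_K//.
  apply: leq_trans (size_polyMleq _ _) _.
  by rewrite s1 addnS/= addnC leq_add2l size_poly.
have XE (r : 'rV_d1) : rVpoly (r *m X) = ((rVpoly r * q) %/ p1) %% p2.
  by rewrite mul_rV_lin1 /= poly_rV_K// -ltnS -s2 ltn_modp.
pose U := col_mx A B.
have UM : U *m mulmodmx (d1 + d2) (p1 * p2) q =
    block_mx (mulmodmx d1 p1 q) X 0 (mulmodmx d2 p2 q) *m U.
  rewrite /U mul_col_mx mul_block_col mul0mx add0r; congr col_mx.
    apply/row_matrixP => i; rewrite !rowE; move: (delta_mx _ _) => r.
    apply: (can_inj rVpolyK); rewrite mulmxDr !mulmxA linearD/= BE AE mulmodmxE//.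
    by rewrite AE mulmodmxE// XE modp_mul_expand// [_ * p1]mulrC.
  apply/row_matrixP => i; rewrite !rowE; move: (delta_mx _ _) => r.
  apply: (can_inj rVpolyK); rewrite !mulmxA mulmodmxE// !BE mulmodmxE//.
  by rewrite modp_mul_expand// mulrAC modp_mull add0r mulpK// mulrC.
have U0 : \det U != 0.
  rewrite -unitfE -unitmxE -row_free_unit; apply: inj_row_free => r.
  rewrite -[r]hsubmxK mul_row_col => /(congr1 rVpoly).
  rewrite linearD/= AE BE linear0 => rE.
  have r2 : rVpoly (rsubmx r) = 0.
    have /(congr1 (modp_by p1)) := rE; rewrite /modp_by modpD modp_mull addr0 mod0p.
    rewrite modp_small => [rl|]; last by rewrite s1 ltnS size_poly.
    by move/eqP: rE; rewrite rl add0r mulf_eq0 (negPf p10) orbF => /eqP.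
  move: rE; rewrite r2 mul0r addr0 => r1.
  by rewrite -[lsubmx r]rVpolyK -[rsubmx r]rVpolyK r1 r2 !linear0 row_mx0.
apply: (mulfI U0); rewrite /poly_norm -det_mulmx UM det_mulmx det_ublock.
by rewrite mulrC.
Qed.

(** Reducing the rows of the Sylvester matrix modulo p turns its upper half into
    the matrix of multiplication by q and annihilates the lower half. The column
    operations W perform this reduction and keep the coefficients of degree at
    least d, where the lower half is unitriangular since p is monic. *)
Lemma resultant_poly_norm d p q : p \is monic -> size p = d.+1 ->
  resultant q p = poly_norm d p q.
Proof.
move=> pm sp; have -> : d = (size p).-1 by rewrite sp.
have p0 : p != 0 by rewrite monic_neq0.
have sp' : size p = (size p).-1.+1 by rewrite sp.
set D := (size p).-1 in sp' *; set E := (size q).-1.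
have sq : (size q <= E.+1)%N by rewrite leqSpred.
pose R : 'M[k]_(D + E, D) := lin1_mx (poly_rV \o modp_by p \o rVpoly).
have RE (r : 'rV_(D + E)) : rVpoly (r *m R) = rVpoly r %% p.
  by rewrite mul_rV_lin1 /= poly_rV_K// -ltnS -sp' ltn_modp.
pose Bq : 'M[k]_(D, D + E) := lin1_mx (poly_rV \o q \o* rVpoly).
pose Bp : 'M[k]_(E, D + E) := lin1_mx (poly_rV \o p \o* rVpoly).
have BqE (r : 'rV_D) : rVpoly (r *m Bq) = rVpoly r * q.
  rewrite mul_rV_lin1 /= poly_rV_K//.
  apply: leq_trans (size_polyMleq _ _) _.
  rewrite -[(D + E)%N]/((D + E).+1.-1) -addnS -!subn1 leq_sub2r//.
  by rewrite leq_add ?size_poly.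
have BpE (r : 'rV_E) : rVpoly (r *m Bp) = rVpoly r * p.
  rewrite mul_rV_lin1 /= poly_rV_K//.
  apply: leq_trans (size_polyMleq _ _) _.
  by rewrite sp' addnS/= addnC leq_add2l size_poly.
pose W := row_mx R (col_mx 0 1%:M).
have WE : W = block_mx 1%:M 0 (dsubmx R) 1%:M.
  rewrite /W block_mxEh -[R in LHS]vsubmxK; congr (row_mx (col_mx _ _) _).
  apply/row_matrixP => i; rewrite !rowE; move: (delta_mx _ _) => r.
  apply: (can_inj rVpolyK); rewrite mulmx1.
  have -> : r *m usubmx R = row_mx r 0 *m R.
    by rewrite -{2}[R]vsubmxK mul_row_col mul0mx addr0.
  have rE : rVpoly (row_mx r 0 : 'rV_(D + E)) = rVpoly r.
    apply/polyP => j; rewrite !coef_rVpoly.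
    case: insubP => [i' _ ij|]; case: insubP => [j' _ jj|] //=.
    - rewrite -(row_mxEl r (0 : 'rV_E)); congr (row_mx _ _ _ _).
      by apply: val_inj; rewrite /= ij.
    - by rewrite mxE; case: splitP => l; rewrite ?mxE// ij => lj; rewrite lj ltn_ord.
    - by move=> /negP[]; rewrite -jj; apply: leq_trans (ltn_ord j') _; rewrite leq_addr.
  by rewrite RE rE modp_small// sp' ltnS size_poly.
have SW : col_mx Bq Bp *m W = block_mx (mulmodmx D p q) (rsubmx Bq) 0 (rsubmx Bp).
  rewrite /W mul_col_row; congr block_mx.
  - apply/row_matrixP => i; rewrite !rowE; move: (delta_mx _ _) => r.
    by apply: (can_inj rVpolyK); rewrite mulmxA RE BqE mulmodmxE.
  - by rewrite -{1}[Bq]hsubmxK mul_row_col mulmx0 add0r mulmx1.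
  - apply/row_matrixP => i; rewrite !rowE; move: (delta_mx _ _) => r.
    by apply: (can_inj rVpolyK); rewrite mulmxA RE BpE modp_mull mulmx0 linear0.
  - by rewrite -{1}[Bp]hsubmxK mul_row_col mulmx0 add0r mulmx1.
have BpT : \det (rsubmx Bp) = 1.
  rewrite det_trig.
    rewrite big1// => i _; rewrite !mxE /= rVpoly_delta coefXnM ltnNge leq_addl/=.
    by rewrite addnK -[RHS](monicP pm) lead_coefE.
  apply/is_trig_mxP => i j ij; rewrite !mxE /= rVpoly_delta coefXnM.
  case: ltnP => // _; rewrite nth_default// sp' /= -addnBA; last by rewrite ltnW.
  by rewrite -[X in (X < _)%N]addn0 ltn_add2l subn_gt0.
have /(congr1 determinant) := SW.
rewrite det_mulmx WE det_lblock !det1 !mulr1 det_ublock BpT mulr1.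
by [].
Qed.

End PolyNorm.

(** * Stem fields *)

(** The base change matrices are allowed to be rectangular a priori, since the
    dimension of a stem field is not syntactically the degree of P. *)
Lemma det_conjmx (k : fieldType) m n (M : 'M[k]_m) (N : 'M[k]_n)
    (B : 'M[k]_(m, n)) (B' : 'M[k]_(n, m)) :
  B *m B' = 1%:M -> B' *m B = 1%:M -> M *m B = B *m N -> \det M = \det N.
Proof.
move=> BB' B'B MB; have mn : m = n.
  apply/eqP; rewrite eqn_leq.
  have := mulmx1_min BB'; have := mulmx1_min B'B => -> ->//.
case: _ / mn N B B' BB' B'B MB => N B B' BB' B'B MB.
have dB : \det B != 0.
  apply: contra_eq_neq (congr1 determinant BB') => dB.
  by rewrite det_mulmx dB mul0r det1 eq_sym oner_eq0.
by apply: (mulIf dB); rewrite -det_mulmx MB det_mulmx mulrC.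
Qed.

Section StemField.
Variables (k : fieldType) (P : {poly k}) (hP : monic_irreducible_poly P).
Local Notation L := {poly %/ P with hP}.

Definition stem_root : L := in_qpoly P 'X.

Lemma horner_stem_root (q : {poly k}) :
  (map_poly (in_alg L) q).[stem_root] = in_qpoly P q.
Proof.
rewrite -[q in RHS]coefK poly_def linear_sum /=.
rewrite (@horner_coef_wide _ (size q)) ?size_poly//.
apply: eq_bigr => i _; rewrite coef_map linearZ /= rmorphXn /=.
by rewrite -scalerAl mul1r.
Qed.

Lemma in_qpolyE (q : {poly k}) : in_qpoly P q = q %% P :> {poly k}.
Proof. by rewrite /= (mk_monicE hP) Pdiv.IdomainMonic.modpE ?hP.2. Qed.

Lemma root_stem_root : root (map_poly (in_alg L) P) stem_root.
Proof.
by rewrite /root horner_stem_root; apply/eqP/val_inj; rewrite [LHS]in_qpolyE modpp.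
Qed.

Lemma reg_norm_stem d (q : {poly k}) : size P = d.+1 ->
  reg_norm ((map_poly (in_alg L) q).[stem_root]) = poly_norm d P q.
Proof.
move=> sP; rewrite horner_stem_root /reg_norm /poly_norm.
pose B : 'M_(dim L, d) := lin1_mx (poly_rV \o (val : L -> {poly k}) \o @r2v _ L).
pose B' : 'M_(d, dim L) := lin1_mx (@v2r _ L \o in_qpoly P \o rVpoly).
have in_qpolyK (x : L) : in_qpoly P (val x) = x.
  by apply: val_inj; apply: in_qpoly_small; apply: size_mk_monic.
have szL (x : L) : (size (val x) <= d)%N.
  by rewrite -ltnS; apply: leq_trans (size_mk_monic x) _; rewrite (mk_monicE hP) sP.
have BE (r : 'rV_(dim L)) : rVpoly (r *m B) = val (r2v r : L).
  by rewrite mul_rV_lin1 [LHS]poly_rV_K//; apply: szL.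
have B'E (r : 'rV_d) : r *m B' = v2r (in_qpoly P (rVpoly r) : L).
  by rewrite mul_rV_lin1.
apply: (@det_conjmx _ _ _ _ _ B B').
- apply/row_matrixP => i; rewrite !rowE; move: (delta_mx _ _) => r.
  by rewrite mulmxA mulmx1 B'E BE in_qpolyK r2vK.
- apply/row_matrixP => i; rewrite !rowE; move: (delta_mx _ _) => r.
  apply: (can_inj rVpolyK); rewrite mulmxA mulmx1 BE B'E v2rK.
  by rewrite [LHS]in_qpolyE modp_small// sP ltnS size_poly.
apply/row_matrixP => i; rewrite !rowE; move: (delta_mx _ _) => r.
apply: (can_inj rVpolyK); rewrite !mulmxA BE mulmodmxE// BE.
rewrite -[r in LHS]r2vK -v2rM v2rK -[r2v r in LHS]in_qpolyK.
have -> : (in_qpoly P (val (r2v r : L)) : L) * in_qpoly P q =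
    in_qpoly P (val (r2v r : L) * q).
  by rewrite rmorphM.
by rewrite [LHS]in_qpolyE.
Qed.

End StemField.

Section StemMap.
Variables (k : fieldType) (g : {poly k}) (hg : monic_irreducible_poly g).
Variables (L : fieldExtType k) (b : L).
Hypothesis gb : root (map_poly (in_alg L) g) b.

(** The k-morphism from k[X]/(g) to L sending the class of X to b. The proof that
    b is a root of g is an argument, for the morphism structure to be found. *)
Definition stem_map of root (map_poly (in_alg L) g) b :=
  fun x : {poly %/ g with hg} => (map_poly (in_alg L) (val x)).[b].

Lemma stem_map_in_qpoly q : stem_map gb (in_qpoly g q) = (map_poly (in_alg L) q).[b].
Proof.
rewrite /stem_map [val _](in_qpolyE hg) [in RHS](divp_eq q g) rmorphD rmorphM.
by rewrite hornerD hornerM (rootP gb) mulr0 add0r.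
Qed.

Fact stem_map_linear : linear (stem_map gb).
Proof.
move=> c x y; rewrite /stem_map.
have -> : val (c *: x + y) = c *: val x + val y by [].
by rewrite rmorphD /= map_polyZ hornerD hornerZ /= mulr_algl.
Qed.

Fact stem_map_monoid_morphism : monoid_morphism (stem_map gb).
Proof.
split=> [|x y]; first by rewrite -[1]in_qpoly1 stem_map_in_qpoly rmorph1 hornerC.
have -> : x * y = in_qpoly g (val x * val y) by [].
by rewrite stem_map_in_qpoly rmorphM hornerM.
Qed.

HB.instance Definition _ := GRing.isLinear.Build k {poly %/ g with hg} L _
  (stem_map gb) stem_map_linear.
HB.instance Definition _ := GRing.isMonoidMorphism.Build {poly %/ g with hg} L
  (stem_map gb) stem_map_monoid_morphism.

Lemma stem_map_surj x : x \in <<1; b>>%VS -> exists y, stem_map gb y = x.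
Proof.
case/Fadjoin_polyP => p /polyOver1P[q ->] ->.
by exists (in_qpoly g q); rewrite stem_map_in_qpoly.
Qed.

Lemma stem_map_bij : <<1; b>>%VS = fullv -> bijective (stem_map gb).
Proof.
move=> full; have /choice[f fK] : forall x, exists y, stem_map gb y = x.
  by move=> x; apply: stem_map_surj; rewrite full memvf.
by exists f => // y; apply: (fmorph_inj (stem_map gb)); rewrite /= fK.
Qed.

End StemMap.

(** * Sharing out a norm among irreducible factors *)

Section Factor.
Variable k : fieldType.
Implicit Types p q : {poly k}.

Lemma monic_dvd_split p q : p \is monic -> q %| p ->
  exists p1 p2, [/\ p = p1 * p2, p1 \is monic, p2 \is monic & p1 %= q].
Proof.
move=> pm qp; have p0 := monic_neq0 pm.
have q0 : q != 0 by apply: contraTneq qp => ->; rewrite dvd0p.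
have lq : lead_coef q != 0 by rewrite lead_coef_eq0.
pose p1 := (lead_coef q)^-1 *: q.
have p1m : p1 \is monic by rewrite monicE lead_coefZ mulVf.
have p1q : p1 %= q by rewrite eqp_scale ?invr_neq0.
have pE : p = p1 * (p %/ p1) by rewrite mulrC divpK// (eqp_dvdl _ p1q).
exists p1, (p %/ p1); split=> //.
by rewrite -(monicMl _ p1m) -pE.
Qed.

(** The valuations of the norms are additive over the factors of p, as are the
    degrees, so some irreducible factor P has a ratio v(N_P(q)) / deg P that is
    at most the ratio for p. *)
Lemma small_norm_factor (v : discrete_valuation k) q n p :
    p \is monic -> size p = n.+1 -> (0 < n)%N -> poly_norm n p q != 0 ->
  exists P d, [/\ P \is monic, irreducible_poly P, P %| p,
    size P = d.+1 /\ (0 < d)%N &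
    poly_norm d P q != 0 /\
    n%:Z * v (poly_norm d P q) <= d%:Z * v (poly_norm n p q)].
Proof.
elim/ltn_ind: n p => n IHn p pm sp n0 Np.
have [pirr|pred] := EM (irreducible_poly p); first by exists p, n; split.
have [q0 [q01 q0p q0np]] : exists q0 : {poly k},
    [/\ size q0 != 1%N, q0 %| p & ~~ (q0 %= p)].
  apply: contrapT => noq; apply: pred; split; first by rewrite sp.
  by move=> q0 q01 q0p; apply/negPn/negP => q0np; apply: noq; exists q0.
have [p1 [p2 [pE p1m p2m p1q]]] := monic_dvd_split pm q0p.
have s1 : (1 < size p1)%N.
  rewrite ltn_neqAle eq_sym (eqp_size p1q) q01 -(eqp_size p1q).
  by rewrite size_poly_gt0 monic_neq0.
have s2 : (1 < size p2)%N.
  rewrite ltn_neqAle eq_sym size_poly_gt0 (monic_neq0 p2m) andbT.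
  apply: contra q0np => s2; rewrite -(eqp_ltrans p1q) pE.
  move: s2 => /size_poly1P[c c0 ->].
  by rewrite mulrC mul_polyC eqp_sym eqp_scale.
case s1E : (size p1) s1 => [//|d1] d10.
case s2E : (size p2) s2 => [//|d2] d20.
have nE : n = (d1 + d2)%N.
  by move: sp; rewrite pE size_monicM ?monic_neq0// s1E s2E addSn addnS => -[].
move: Np; rewrite nE pE poly_norm_mul// mulf_eq0 negb_or => /andP[N1 N2].
rewrite dvalM//; set a1 := v (poly_norm d1 _ _); set a2 := v (poly_norm d2 _ _).
have reduce d (pi : {poly k}) : pi \is monic -> pi %| p ->
    size pi = d.+1 -> (0 < d)%N -> (d < n)%N -> poly_norm d pi q != 0 ->
    (d1 + d2)%N%:Z * v (poly_norm d pi q) <= d%:Z * (a1 + a2) ->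
    exists P d, [/\ P \is monic, irreducible_poly P, P %| p1 * p2,
      size P = d.+1 /\ (0 < d)%N & poly_norm d P q != 0 /\
      (d1 + d2)%N%:Z * v (poly_norm d P q) <= d%:Z * (a1 + a2)].
  move=> pim pip spi d0 dn Ni le.
  have [P [e [Pm Pirr Ppi sP [NP leP]]]] := IHn d dn pi pim spi d0 Ni.
  exists P, e; split=> //; first by rewrite -pE (dvdp_trans Ppi).
  split=> //; move: le leP d0; set b := v _; set c := v _; clear; nia.
have [le|gt] := leP ((d1 + d2)%N%:Z * a1) (d1%:Z * (a1 + a2)).
  by apply: (reduce d1 p1) => //; rewrite ?pE ?dvdp_mulr//; lia.
apply: (reduce d2 p2) => //; rewrite ?pE ?dvdp_mull//; first by lia.
by move: gt; rewrite -/a2; clear; nia.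
Qed.

End Factor.

(** * Gauss's lemma *)

Section Gauss.
Variables (k : fieldType) (v : discrete_valuation k).
Implicit Types (g h : {poly k}) (F : {poly valuation_ring v}).

Lemma poly_over_field_inj : injective (@poly_over_field k v).
Proof. by apply: map_inj_poly => //; apply: val_inj. Qed.

Lemma size_poly_over_field F : size (poly_over_field F) = size F.
Proof. by rewrite size_map_inj_poly//; apply: val_inj. Qed.

Lemma poly_over_field_monic F : (poly_over_field F \is monic) = (F \is monic).
Proof.
by rewrite !monicE lead_coef_map_inj ?rmorph0//; apply: val_inj.
Qed.

Lemma poly_over_fieldP F : poly_over_field F \is a polyOver (vge v 0).
Proof. by apply/polyOverP => i; rewrite coef_map; apply: valP. Qed.

Lemma poly_over_field_lift g : g \is a polyOver (vge v 0) ->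
  exists F, poly_over_field F = g.
Proof.
move=> /polyOverP gO; exists (\poly_(i < size g) insubd (0 : valuation_ring v) g`_i).
apply/polyP => i; rewrite coef_map coef_poly.
case: ltnP => [_|ig]; last by rewrite nth_default.
by rewrite /= insubdK.
Qed.

Lemma primitive_scaling g : g != 0 -> exists (c : k) F,
  [/\ c != 0, poly_over_field F = c *: g & map_poly (@residue k v) F != 0].
Proof.
move=> g0; have g1 : ((size g).-1 < size g)%N by rewrite prednK// size_poly_gt0.
have lg : g`_(Ordinal g1) != 0 by rewrite /= -lead_coefE lead_coef_eq0.
have [j gj jmin] := @arg_minP _ _ _ (Ordinal g1) (fun j => g`_j != 0)
  (fun j => v g`_j) lg.
have cgO i : (g`_j)^-1 * g`_i \in vge v 0.
  have [->|gi] := eqVneq g`_i 0; first by rewrite mulr0 vge0.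
  have ig : (i < size g)%N.
    by rewrite ltnNge; apply: contra gi => /(nth_default _)->.
  rewrite vgeE dvalM ?invr_neq0// dvalV// addrC subr_ge0.
  by rewrite (jmin (Ordinal ig)) ?orbT.
have [|F FE] := @poly_over_field_lift ((g`_j)^-1 *: g).
  by apply/polyOverP => i; rewrite coefZ.
exists (g`_j)^-1, F; split; rewrite ?invr_neq0//.
apply: contraTneq isT => /(congr1 (fun p : {poly _} => p`_j)).
rewrite coef_map coef0 => /eqP; rewrite residue_eq0 maximal_idealE.
have -> : val F`_j = 1 by rewrite -coef_map [map_poly _ _]FE coefZ mulVf.
by rewrite vgeN0 ?oner_neq0// dval1.
Qed.

(** Gauss's lemma: scaled to be primitive, g and h have nonzero images over the
    residue field, hence so has their product. So the product of the two scaling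
    factors is a unit, and these factors are integral as g and h are monic. *)
Lemma gauss_monic g h : g \is monic -> h \is monic ->
  g * h \is a polyOver (vge v 0) -> g \is a polyOver (vge v 0).
Proof.
move=> gm hm ghO; have g0 := monic_neq0 gm; have h0 := monic_neq0 hm.
have [c [A [c0 AE A0]]] := primitive_scaling g0.
have [d [B [d0 BE B0]]] := primitive_scaling h0.
have scaleO (e : k) (f : {poly k}) (E : {poly valuation_ring v}) :
    f \is monic -> poly_over_field E = e *: f -> 0 <= v e \/ e = 0.
  move=> fm EE; have := polyOverP (poly_over_fieldP E) (size f).-1.
  rewrite EE coefZ -lead_coefE (monicP fm) mulr1 vgeE.
  by case: eqP => [->|_ /= ?]; [right|left].
have [vc|] := scaleO _ _ _ gm AE; last by move/eqP: c0.
have [vd|] := scaleO _ _ _ hm BE; last by move/eqP: d0.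
have [cd|cd] := eqVneq (v c + v d) 0.
  have vc0 : v c = 0 by move: vc vd cd; clear; lia.
  have -> : g = c^-1%:P * poly_over_field A by rewrite AE mul_polyC scalerK.
  by rewrite rpredM ?poly_over_fieldP// polyOverC vgeN0 ?invr_neq0// dvalV// vc0.
have /eqP[] : map_poly (@residue k v) A * map_poly (@residue k v) B != 0.
  by rewrite mulf_neq0.
rewrite -rmorphM; apply/polyP => i; rewrite coef_map coef0; apply/eqP.
rewrite residue_eq0 maximal_idealE.
have -> : val (A * B)`_i = c * d * (g * h)`_i.
  have ABE : poly_over_field (A * B) = c * d *: (g * h).
    rewrite /poly_over_field rmorphM /=.
    rewrite -/(poly_over_field A) -/(poly_over_field B).
    by rewrite AE BE -scalerAl -scalerAr scalerA.
  by rewrite -coefZ -ABE coef_map.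
rewrite -[1]addr0 vgeM ?(polyOverP ghO)// vgeN0 ?mulf_neq0// dvalM//.
move: vc vd cd; clear; lia.
Qed.

Lemma irreducible_elt_poly F : F \is monic ->
  irreducible_elt F <-> irreducible_poly (poly_over_field F).
Proof.
move=> Fm; have Fm' : poly_over_field F \is monic by rewrite poly_over_field_monic.
have sF : (0 < size F)%N by rewrite size_poly_gt0 monic_neq0.
split=> [[F0 Fu Firr]|[F1 Firr]].
  split=> [|q q1 qF].
    rewrite size_poly_over_field ltn_neqAle eq_sym sF andbT.
    apply: contra Fu => /size_poly1P[c c0 FE].
    by move: Fm; rewrite FE monicE lead_coefC => /eqP ->; rewrite unitr1.
  have [p1 [p2 [FE p1m p2m p1q]]] := monic_dvd_split Fm' qF.
  have FO := poly_over_fieldP F; rewrite FE in FO.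
  have [f1 f1E] := poly_over_field_lift (gauss_monic p1m p2m FO).
  have [f2 f2E] : exists f2 : {poly valuation_ring v}, poly_over_field f2 = p2.
    by apply: poly_over_field_lift; apply: (gauss_monic p2m p1m); rewrite mulrC.
  have : F = f1 * f2.
    by apply: poly_over_field_inj; rewrite FE /poly_over_field rmorphM /= -f1E -f2E.
  case/Firr; rewrite poly_unitE => /andP[/eqP s _].
    by move: q1; rewrite -(eqp_size p1q) -f1E size_poly_over_field s.
  rewrite eqp_sym in p1q; apply: eqp_trans p1q _; rewrite FE.
  have /size_poly1P[c c0 ->] : size p2 == 1%N by rewrite -f2E size_poly_over_field s.
  by rewrite mulrC mul_polyC eqp_sym eqp_scale.
split; first exact: monic_neq0.
  rewrite poly_unitE negb_and; apply/orP; left.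
  by move: F1; rewrite size_poly_over_field; case: eqP => // ->.
have half b c : F = b * c -> size (poly_over_field b) = 1%N -> b \is a GRing.unit.
  rewrite size_poly_over_field poly_unitE => FE sb; rewrite sb/=.
  have := monicP Fm; rewrite FE lead_coefM => bc.
  have : lead_coef b \is a GRing.unit by apply/unitrPr; exists (lead_coef c).
  by rewrite lead_coefE sb.
move=> b c FE; have [sb|sb] := eqVneq (size (poly_over_field b)) 1%N.
  by left; apply: half FE sb.
right; apply: (half c b); first by rewrite mulrC.
have FE' : poly_over_field F = poly_over_field b * poly_over_field c.
  by rewrite FE /poly_over_field rmorphM.
have bF : poly_over_field b %= poly_over_field F.
  by apply: Firr sb _; rewrite FE' dvdp_mulr.
have bc0 : poly_over_field b * poly_over_field c != 0 by rewrite -FE' monic_neq0.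
move: (eqp_size bF); rewrite FE' size_mul;
  [|by move: bc0; rewrite mulf_eq0 negb_or => /andP[]..].
move: bc0; rewrite mulf_eq0 negb_or -!size_poly_gt0 => /andP[].
by move: (size _) (size _) => x y; clear; lia.
Qed.

End Gauss.

(** * The discriminant as a norm *)

Lemma resultant_map_inj (aR rR : nzRingType) (f : {rmorphism aR -> rR})
    (p q : {poly aR}) :
  injective f -> f (resultant p q) = resultant (map_poly f p) (map_poly f q).
Proof.
move=> f_inj; rewrite /resultant /Sylvester_mx !size_map_inj_poly ?rmorph0//.
rewrite -det_map_mx map_col_mx; congr (\det (col_mx _ _));
  by apply: map_lin1_mx => r; rewrite /= map_poly_rV rmorphM /= map_rVpoly.
Qed.

Lemma delta_poly_norm (k : fieldType) (v : discrete_valuation k) n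
    (F : {poly valuation_ring v}) (f := poly_over_field F) :
  F \is monic -> size F = n.+1 -> separable_poly f ->
  poly_norm n f f^`() != 0 /\ delta F = v (poly_norm n f f^`()).
Proof.
move=> Fm sF fsep.
have fm : f \is monic by rewrite poly_over_field_monic.
have sf : size f = n.+1 by rewrite size_poly_over_field.
have N0 : poly_norm n f f^`() != 0.
  rewrite -resultant_poly_norm// resultant_eq0 -leqNgt.
  by move: fsep; rewrite unlock coprimep_sym /coprimep => /eqP->.
split=> //; rewrite /delta /Disc rmorphM rmorphXn rmorphN1 /=.
have -> : val (resultant F^`() F) = resultant f^`() f.
  by rewrite /f /poly_over_field deriv_map; apply: resultant_map_inj; apply: val_inj.
rewrite (resultant_poly_norm _ fm sf) dvalM ?expf_neq0 ?oppr_eq0 ?oner_eq0//.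
by rewrite dvalX ?oppr_eq0 ?oner_eq0// dvalN1 mul0r add0r.
Qed.

(** * Simple extensions generated by a root *)

Section Degree.
Variables (k : fieldType) (L : fieldExtType k).
Local Notation inL p := (map_poly (in_alg L) p).

Lemma dim_adjoin_root (p : {poly k}) n (x : L) :
  irreducible_poly p -> size p = n.+1 -> root (inL p) x -> \dim <<1; x>> = n.
Proof.
move=> [_ pirr] sp px; have /polyOver1P[q qE] := minPolyOver 1 x.
have qp : q %| p.
  by rewrite -(dvdp_map (in_alg L)) -qE minPoly_dvdp//; apply/polyOver1P; exists p.
have sq : size q = (adjoin_degree 1 x).+1.
  by rewrite -(size_minPoly 1%VS x) qE size_map_poly.
have /eqp_size : q %= p by apply: pirr => //; rewrite sq.
by rewrite sp sq => -[<-]; rewrite dim_Fadjoin dimv1 muln1.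
Qed.

Lemma irreducible_adjoin_root (p : {poly k}) n (x : L) :
  p \is monic -> size p = n.+1 -> root (inL p) x -> \dim <<1; x>> = n ->
  irreducible_poly p.
Proof.
move=> pm sp px dx; have p0 := monic_neq0 pm.
have mE : minPoly 1 x = inL p.
  apply/eqP; rewrite -eqp_monic ?monic_minPoly ?map_monic//.
  have mp : minPoly 1 x %| inL p.
    by rewrite minPoly_dvdp//; apply/polyOver1P; exists p.
  rewrite -dvdp_size_eqp// size_minPoly size_map_poly sp.
  by rewrite -dx dim_Fadjoin dimv1 muln1.
split=> [|q q1 qp].
  by rewrite -(size_map_poly (in_alg L)) -mE size_minPoly.
have qO : inL q \is a polyOver 1%VS by apply/polyOver1P; exists q.
have := @minPoly_irr _ _ 1%AS x _ qO; rewrite [minPoly _ _]mE dvdp_map.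
move=> /(_ qp) /orP[|]; first by rewrite eqp_map.
by move/eqp_size; rewrite size_map_poly size_poly1 => s; rewrite s in q1.
Qed.

End Degree.

(** * Approximate roots *)

(** If w(a) < 0, the leading term of p(a) has a smaller valuation than all the
    others. *)
Lemma monic_root_integral (L : fieldType) (w : discrete_valuation L) (p : {poly L}) a :
  p \is monic -> p \is a polyOver (vge w 0) -> root p a -> a \in vge w 0.
Proof.
move=> pm pO pa; rewrite vgeE; have [//|a0 /=] := eqVneq a 0.
rewrite leNgt; apply/negP => wa.
have p0 := monic_neq0 pm.
have sp : (1 < size p)%N.
  rewrite ltnNge; apply/negP => /size1_polyC pE.
  by move: pa; rewrite pE rootC -polyC_eq0 -pE (negPf p0).
case sE : (size p) sp => [//|[//|n]] _.
have : a ^+ n.+1 \in vge w (n%:Z * w a).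
  have -> : a ^+ n.+1 = - \sum_(i < n.+1) p`_i * a ^+ i.
    move/rootP: pa; rewrite horner_coef sE big_ord_recr /=.
    have := monicP pm; rewrite lead_coefE sE /= => ->.
    by rewrite mul1r addrC => /eqP; rewrite addr_eq0 => /eqP.
  rewrite vge_opp; apply: vge_sum => i _.
  rewrite -[_ * w a]add0r vgeM ?(polyOverP pO)//.
  rewrite vgeN0 ?expf_neq0// dvalX//; have := ltn_ord i; move: wa; clear.
  case: i => i /= _; nia.
rewrite vgeN0 ?expf_neq0// dvalX//; move: wa; clear; nia.
Qed.

Section ApproximateRoot.
Variables (k : fieldType) (v : discrete_valuation k) (L : fieldExtType k).
Variables (w : discrete_valuation L) (e : nat).
Hypothesis we : ramification_index v w e.
Local Notation inL p := (map_poly (in_alg L) p).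

Lemma vge_in_alg m c : c \in vge v m -> c%:A \in vge w (e%:Z * m).
Proof.
rewrite !vgeE scaler_eq0 oner_eq0 orbF; have [//|c0 /=] := eqVneq c 0.
by case: we => e0 -> // le; rewrite ler_pM2l.
Qed.

Lemma polyOver_in_alg p :
  p \is a polyOver (vge v 0) -> inL p \is a polyOver (vge w 0).
Proof.
move=> /polyOverP pO; apply/polyOverP => i; rewrite coef_map.
by have := vge_in_alg (pO i); rewrite mulr0.
Qed.

Lemma horner_congr (p : {poly L}) m x : (forall i, p`_i \in vge w m) ->
  x \in vge w 0 -> p.[x] \in vge w m.
Proof.
move=> pm xO; rewrite horner_coef vge_sum// => i _.
by rewrite -[m]addr0 vgeM// rpredX.
Qed.

(** The values at a of g and of its derivative are those of f up to valuation
    e nu, which is more than twice the valuation of f'(a). The last conclusion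
    allows the roles of (f, a) and (g, b) to be exchanged. *)
Lemma approximate_root (E : {subfield L}) (f g : {poly k}) (nu : nat) a :
    bolzano_weierstrass w E ->
    f \is monic -> f \is a polyOver (vge v 0) -> g \is a polyOver (vge v 0) ->
    (forall i, (g - f)`_i \in vge v nu%:Z) ->
    a \in E -> root (inL f) a -> (inL f)^`().[a] != 0 ->
    2 * w (inL f)^`().[a] < e%:Z * nu%:Z ->
  exists b, [/\ b \in E, root (inL g) b, (inL g)^`().[b] != 0 &
    w (inL g)^`().[b] = w (inL f)^`().[a]].
Proof.
move=> cluster fm fO gO gf aE fa f'a0 lt.
have fO' := polyOver_in_alg fO; have gO' := polyOver_in_alg gO.
have fm' : inL f \is monic by rewrite map_monic.
have aO : a \in vge w 0 := monic_root_integral fm' fO' fa.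
have gfO i : (inL g - inL f)`_i \in vge w (e%:Z * nu%:Z).
  by rewrite -rmorphB coef_map vge_in_alg.
have d0 : 0 <= w (inL f)^`().[a].
  by rewrite -(vgeN0 w 0)// rpred_horner// polyOver_deriv.
set d := w (inL f)^`().[a] in lt d0 *.
have [g'a0 wg'a] : (inL g)^`().[a] != 0 /\ w (inL g)^`().[a] = d.
  rewrite -(subrKC (inL f) (inL g)) derivD hornerD; apply: dval_addl => //.
  apply: horner_congr => // i; rewrite coef_deriv vge_natmul//.
  by apply: vge_le (gfO _); move: lt d0; clear; lia.
have [|||||||b [bE gb ba]] :=
  newton_root (w := w) (E := E) (g := inL g) (a := a).
- exact: cluster.
- exact: gO'.
- by apply/polyOverP => i; rewrite coef_map rpredZ// rpred1.
- exact: aO.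
- exact: aE.
- exact: g'a0.
- have -> : (inL g).[a] = (inL g - inL f).[a].
    by rewrite hornerD hornerN (rootP fa) subr0.
  apply: horner_congr => // i; apply: vge_le (gfO i).
  by rewrite wg'a; move: lt; clear; lia.
have bO : b \in vge w 0.
  rewrite -(subrK a b); apply: vgeD aO; apply: vge_le ba.
  by rewrite wg'a; move: d0; clear; lia.
exists b.
have [] := @dval_addl _ w d (inL g)^`().[a]
  ((inL g)^`().[b] - (inL g)^`().[a]) g'a0 wg'a.
  by apply: integral_horner_diff; rewrite ?polyOver_deriv// -wg'a.
by rewrite subrKC.
Qed.

End ApproximateRoot.

Section Stem.
Variables (k : fieldType) (v : discrete_valuation k).
Hypothesis lcv : v_locally_compact v.

Lemma dim_stem (P : {poly k}) (hP : monic_irreducible_poly P) d :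
  size P = d.+1 -> dim {poly %/ P with hP} = d.
Proof.
by move=> sP; rewrite -[dim _]dimvf [LHS]dim_polyn (mk_monicE hP) sP.
Qed.

(** The first application of Newton's method starts at the root of P and looks
    for a root of g; the second one goes back from g to f, inside k(b). The
    hypothesis on the norm of f' makes v(N(f'(a))) / d at most delta(f) / n. *)
Lemma stem_roots (f g P : {poly k}) (hP : monic_irreducible_poly P)
    (n d nu : nat) :
    f \is monic -> f \is a polyOver (vge v 0) ->
    g \is monic -> g \is a polyOver (vge v 0) ->
    (forall i, (g - f)`_i \in vge v nu%:Z) ->
    P %| f -> size P = d.+1 -> (0 < n)%N ->
    poly_norm d P f^`() != 0 ->
    n%:Z * v (poly_norm d P f^`()) <= d%:Z * v (poly_norm n f f^`()) ->
    2 * v (poly_norm n f f^`()) < n%:Z * nu%:Z ->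
  exists b : {poly %/ P with hP}, root (map_poly (in_alg _) g) b /\
    exists2 a : {poly %/ P with hP}, a \in <<1; b>>%VS &
      root (map_poly (in_alg _) f) a.
Proof.
move=> fm fO gm gO gf Pf sP n0 N0 le lt.
have [w [e [g0 [we eg wN [K lK]]]]] :=
  extend_valuation {poly %/ P with hP} lcv.
have bw (E : {subfield {poly %/ P with hP}}) :
  bolzano_weierstrass w E.
  by case: (we) => e0 _; apply: (subspace_bolzano_weierstrass lcv e0 lK).
pose a := stem_root hP.
have fa : root (map_poly (in_alg {poly %/ P with hP}) f) a.
  by have /dvdpP[q ->] := Pf; rewrite rmorphM rootM root_stem_root orbT.
have Nf' := reg_norm_stem hP f^`() sP.
have d0 : (0 < d)%N by rewrite -ltnS -sP; case: (hP) => [[]].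
have f'a0 : (map_poly (in_alg {poly %/ P with hP}) f)^`().[a] != 0.
  apply: contraNneq N0 => f'a; rewrite -Nf' -deriv_map f'a -(scale0r 1) reg_normA.
  by rewrite expr0n (dim_stem hP sP) eqn0Ngt d0.
have := wN _ f'a0; rewrite deriv_map Nf' => wf'.
have eg' : (e * g0)%N = d by rewrite eg (dim_stem hP sP).
have lt' :
    2 * w (map_poly (in_alg {poly %/ P with hP}) f)^`().[a] < e%:Z * nu%:Z.
  rewrite deriv_map; move: le lt; rewrite wf' -eg'.
  move: (w _) (v _) => x y.
  have [eg0 g00] : (0 < e)%N /\ (0 < g0)%N.
    by move: d0; rewrite -eg' muln_gt0 => /andP.
  have -> : n%:Z * (g0%:Z * x) = g0%:Z * (n%:Z * x) by ring.
  have -> : (e * g0)%N%:Z * y = g0%:Z * (e%:Z * y) by rewrite PoszM; ring.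
  rewrite ler_pM2l// => le lt; rewrite -(@ltr_pM2l _ n%:Z)//.
  have -> : n%:Z * (e%:Z * nu%:Z) = e%:Z * (n%:Z * nu%:Z) by ring.
  apply: le_lt_trans (_ : e%:Z * (2 * y) < _); last by rewrite ltr_pM2l.
  by rewrite !(mulrCA _ 2) ler_pM2l.
have [b [_ gb g'b0 wg'b]] := approximate_root we
  (bw {:{poly %/ P with hP}}%AS) fm fO gO gf (memvf a) fa f'a0 lt'.
exists b; split=> //.
have [|||a' [aE fa' _ _]] := approximate_root (g := f) (nu := nu) we
  (bw <<1; b>>%AS) gm gO fO _ _ gb g'b0.
- by move=> i; rewrite -opprB coefN vgeN.
- exact: memv_adjoin.
- by rewrite wg'b.
by exists a'.
Qed.

End Stem.

(** * Maximal tamely ramified subextensions *)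

Section TameTransport.
Variables (k : fieldType) (v : discrete_valuation k).

(** Lifting the coefficients of p turns a root in the residue field into a
    congruence in K, which a k-isomorphism can transport. *)
Lemma root_residue_incl (K : fieldExtType k) (w : discrete_valuation K) e
    (p : {poly residue_field v}) (A : valuation_ring w) :
  ramification_index v w e ->
  root (map_poly (residue_incl w) p) (residue A) =
  ((\poly_(i < size p) (val (residue_lift p`_i))%:A).[val A] \in vge w 1).
Proof.
move=> we; pose P := \poly_(i < size p) vr_incl w (residue_lift p`_i).
have -> : map_poly (residue_incl w) p = map_poly (@residue K w) P.
  apply/polyP => i; rewrite coef_map !coef_poly.
  by case: ifP => // _; rewrite raddf0.
rewrite /root horner_map residue_eq0 maximal_idealE.
have -> : val P.[A] = (map_poly val P).[val A] by rewrite horner_map.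
suff -> : map_poly val P =
  \poly_(i < size p) (val (residue_lift p`_i))%:A :> {poly K} by [].
apply/polyP => i; rewrite coef_map !coef_poly; case: ifP => // _.
by rewrite /= (vr_inclE _ we).
Qed.

Lemma tamely_ramified_iso (K K' : fieldExtType k) (f : {lrmorphism K -> K'}) :
  bijective f -> tamely_ramified v K -> tamely_ramified v K'.
Proof.
case=> f' fK f'K [w [e [we wsep tame]]].
have f'0 x : x != 0 -> f' x != 0.
  by apply: contra_neq => f'x; rewrite -[x]f'K f'x rmorph0.
have f'M x y : f' (x * y) = f' x * f' y.
  by apply: (can_inj fK); rewrite rmorphM /= !f'K.
have f'D x y : f' (x + y) = f' x + f' y.
  by apply: (can_inj fK); rewrite rmorphD /= !f'K.
have f'A c : f' c%:A = c%:A.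
  by apply: (can_inj fK); rewrite f'K linearZ /= rmorph1.
have w'M x y : x != 0 -> y != 0 -> w (f' (x * y)) = w (f' x) + w (f' y).
  by move=> x0 y0; rewrite f'M dvalM ?f'0.
have w'D x y : x != 0 -> y != 0 -> x + y != 0 ->
    Num.min (w (f' x)) (w (f' y)) <= w (f' (x + y)).
  by move=> x0 y0 xy0; rewrite f'D dvalD -?f'D ?f'0.
have w'_surj m : exists2 x, x != 0 & w (f' x) = m.
  by have [x x0 wx] := dval_surj w m; exists (f x); rewrite ?fmorph_eq0// fK.
pose w' := DiscreteValuation w'M w'D w'_surj.
have vge_f m x : (f x \in vge w' m) = (x \in vge w m).
  by rewrite !vgeE fmorph_eq0 /= fK.
have w'e : ramification_index v w' e.
  by case: we => e0 we; split=> // c c0; rewrite /= f'A we.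
exists w', e; split=> // b.
have AO : f' (val (residue_lift b)) \in vge w 0.
  by rewrite -vge_f f'K; apply: valP.
have [p psep proot] := wsep (residue (ValuationRing AO)); exists p => //.
rewrite -[b]residue_liftK (root_residue_incl _ _ w'e).
move: proot; rewrite (root_residue_incl _ _ we) -vge_f.
set q := \poly_(i < _) _; set q' := \poly_(i < _) _ => fq.
have -> : q' = map_poly f q.
  apply/polyP => i; rewrite coef_map !coef_poly; case: ifP => _; last by rewrite raddf0.
  by rewrite /= linearZ /= rmorph1.
by rewrite -(f'K (val (residue_lift b))) horner_map.
Qed.

End TameTransport.

Section SubfieldImage.
Variables (k : fieldType) (L1 L2 : fieldExtType k) (h : 'AHom(L1, L2)).
Variable A : {subfield L1}.

Definition subfield_image (x : subvs_of A) : subvs_of (h @: A)%VS :=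
  vsproj (h @: A)%VS (h (vsval x)).

Lemma val_subfield_image x : vsval (subfield_image x) = h (vsval x).
Proof. by rewrite vsprojK// memv_img// subvsP. Qed.

Fact subfield_image_linear : linear subfield_image.
Proof.
move=> c x y; apply: val_inj.
by rewrite linearP /= !val_subfield_image linearP.
Qed.

Fact subfield_image_monoid_morphism : monoid_morphism subfield_image.
Proof.
split=> [|x y]; apply: val_inj.
  by rewrite [LHS]val_subfield_image /= !algid1 rmorph1.
by rewrite [LHS]val_subfield_image /= !val_subfield_image rmorphM.
Qed.

HB.instance Definition _ := GRing.isLinear.Build k (subvs_of A)
  (subvs_of (h @: A)%VS) _ subfield_image subfield_image_linear.
HB.instance Definition _ := GRing.isMonoidMorphism.Build (subvs_of A)
  (subvs_of (h @: A)%VS) subfield_image subfield_image_monoid_morphism.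

Lemma subfield_image_bij : bijective subfield_image.
Proof.
have /choice[f fK] : forall y, exists x, subfield_image x = y.
  move=> y; have /memv_imgP[x xA yE] := subvsP y.
  by exists (Subvs xA); apply: val_inj; rewrite [LHS]val_subfield_image.
by exists f => // x; apply: (fmorph_inj subfield_image); rewrite /= fK.
Qed.

End SubfieldImage.

Section MaximalTame.
Variables (k : fieldType) (v : discrete_valuation k).

(** The common upper bounds of the tamely ramified subfields are stable under
    intersection, so one of least dimension is the least. *)
Lemma maximal_tame_exists (L : fieldExtType k) :
  exists T : {subfield L}, maximal_tame_subextension v T.
Proof.
pose ub (T : {subfield L}) := forall E : {subfield L},
  tamely_ramified v (subvs_of E) -> (E <= T)%VS.
have ex : exists n, `[< exists2 T : {subfield L}, ub T & \dim T = n >].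
  by exists (\dim {:L}); apply/asboolP; exists {:L}%AS => // E _; apply: subvf.
case: (ex_minnP ex) => n /asboolP[T Tub Tn] nmin.
exists T; split=> // T' T'ub.
have TT' : ub (T :&: T')%AS by move=> E tE; rewrite subv_cap Tub//= T'ub.
have le : (n <= \dim (T :&: T'))%N.
  by apply: nmin; apply/asboolP; exists (T :&: T')%AS.
by apply/capv_idPl/eqP; rewrite eqEdim capvSl Tn.
Qed.

Lemma maximal_tame_image (L1 L2 : fieldExtType k) (h : 'AHom(L1, L2))
    (h' : 'AHom(L2, L1)) (T : {subfield L1}) :
  cancel h h' -> cancel h' h ->
  maximal_tame_subextension v T -> maximal_tame_subextension v (h @: T)%AS.
Proof.
move=> hK h'K [Tub Tmin].
have imgK (U : {vspace L2}) : (h @: (h' @: U))%VS = U.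
  rewrite -limg_comp; apply/eqP; rewrite -[X in _ == X]lim1g; apply/eqP.
  by congr (_ @: _)%VS; apply/lfunP => x; rewrite comp_lfunE /= h'K id_lfunE.
have imgK' (U : {vspace L1}) : (h' @: (h @: U))%VS = U.
  rewrite -limg_comp; apply/eqP; rewrite -[X in _ == X]lim1g; apply/eqP.
  by congr (_ @: _)%VS; apply/lfunP => x; rewrite comp_lfunE /= hK id_lfunE.
split=> [E tE|T' T'ub].
  rewrite -(imgK E) limgS//; apply: (Tub (h' @: E)%AS).
  exact: tamely_ramified_iso (subfield_image_bij h' E) tE.
rewrite -(imgK T') limgS//; apply: (Tmin (h' @: T')%AS) => E tE.
rewrite -(imgK' E) limgS//; apply: (T'ub (h @: E)%AS).
exact: tamely_ramified_iso (subfield_image_bij h E) tE.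
Qed.

Lemma maximal_tame_iso (L1 L2 : fieldExtType k) (f : {lrmorphism L2 -> L1}) :
  bijective f -> exists (T1 : {subfield L1}) (T2 : {subfield L2}),
   [/\ maximal_tame_subextension v T1, maximal_tame_subextension v T2 &
      exists h : {lrmorphism subvs_of T1 -> subvs_of T2}, bijective h].
Proof.
case=> f' fK f'K; have [T1 T1max] := maximal_tame_exists L1.
have lf : lker (linfun f) == 0%VS.
  by apply/lker0P => x y; rewrite !lfunE => /(can_inj fK).
have f'M : ahom_in {:L1} (linfun f)^-1.
  have inv x : ((linfun f)^-1)%VF x = f' x.
    by rewrite -{1}[x]f'K -[f _](lfunE f) lker0_lfunK.
  apply/ahom_inP; split=> [x y _ _|]; rewrite !inv; apply: (can_inj fK).
    by rewrite rmorphM /= !f'K.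
  by rewrite f'K rmorph1.
pose h : 'AHom(L1, L2) := AHom f'M.
have fhK : cancel (linfun_ahom f) h by move=> x; apply: lker0_lfunK.
have hfK : cancel h (linfun_ahom f).
  by move=> x; rewrite -[x]f'K -[f _](lfunE f) [h _]fhK.
exists T1, (h @: T1)%AS; split=> //.
  exact: maximal_tame_image hfK fhK T1max.
by eexists; apply: (subfield_image_bij h).
Qed.

End MaximalTame.

(** * Irreducibility under approximation *)

Section Approximation.
Variables (k : fieldType) (v : discrete_valuation k).
Hypothesis lcv : v_locally_compact v.
Variables (f g : {poly k}) (n nu : nat).
Hypotheses (n_gt0 : (0 < n)%N) (fm : f \is monic) (gm : g \is monic).
Hypotheses (fO : f \is a polyOver (vge v 0)) (gO : g \is a polyOver (vge v 0)).
Hypotheses (sf : size f = n.+1) (sg : size g = n.+1).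
Hypothesis fg : forall i, (g - f)`_i \in vge v nu%:Z.
Hypothesis Nf : poly_norm n f f^`() != 0.
Hypothesis nu_gt : 2 * v (poly_norm n f f^`()) < n%:Z * nu%:Z.

(** f has a root in k(b), so k(b) has degree at least n. *)
Lemma approximation_generates (hf : monic_irreducible_poly f) :
  exists2 b : {poly %/ f with hf},
    root (map_poly (in_alg _) g) b & <<1; b>>%VS = fullv.
Proof.
have [b [gb [a ab fa]]] :=
  stem_roots lcv hf fm fO gm gO fg (dvdpp f) sf n_gt0 Nf (lexx _) nu_gt.
exists b => //; apply/eqP; rewrite eqEdim subvf dimvf (dim_stem hf sf).
rewrite -(dim_adjoin_root hf.1 sf fa) dimvS//.
by apply/FadjoinP; rewrite sub1v.
Qed.

(** For the converse, g has a root in the stem field of a well-chosen factor P of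
    f, which therefore has degree at least n. *)
Lemma irreducible_approximation : irreducible_poly f <-> irreducible_poly g.
Proof.
split=> [firr|girr].
  pose hf : monic_irreducible_poly f := (firr, fm).
  have [b gb b_full] := approximation_generates hf.
  by apply: irreducible_adjoin_root gm sg gb _; rewrite b_full dimvf (dim_stem hf sf).
have [P [d [Pm Pirr Pf [sP d_gt0] [NP le]]]] := small_norm_factor v fm sf n_gt0 Nf.
pose hP : monic_irreducible_poly P := (Pirr, Pm).
have [b [gb _]] := stem_roots lcv hP fm fO gm gO fg Pf sP n_gt0 NP le nu_gt.
have nd : (n <= d)%N.
  by rewrite -(dim_adjoin_root girr sg gb) -(dim_stem hP sP) -dimvf dimvS// subvf.
suff -> : f = P by [].
apply/eqP; rewrite eq_sym -eqp_monic// -dvdp_size_eqp// eqn_leq.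
by rewrite dvdp_leq ?monic_neq0// sf sP.
Qed.

End Approximation.

Theorem corollary2p4 (k : fieldType) (v : discrete_valuation k)
    (k_complete : v_complete v) (k_lcompact : v_locally_compact v)
    (n nu : nat) (F G : {poly valuation_ring v})
    (n_gt0 : (0 < n)%N)
    (F_monic : F \is monic) (G_monic : G \is monic)
    (F_deg : size F = n.+1) (G_deg : size G = n.+1)
    (F_sep : separable_poly (poly_over_field F))
    (G_sep : separable_poly (poly_over_field G))
    (nu_gt0 : (0 < nu)%N)
    (nu_gt : 2%:Q * (delta F)%:Q / n%:Q < nu%:Q)
    (FG : poly_congr_mod nu F G) :
  (irreducible_elt F <-> irreducible_elt G) /\
  (irreducible_elt F ->
   exists (hF : monic_irreducible_poly (poly_over_field F))
          (hG : monic_irreducible_poly (poly_over_field G))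
          (TF : {subfield {poly %/ poly_over_field F with hF}})
          (TG : {subfield {poly %/ poly_over_field G with hG}}),
     [/\ maximal_tame_subextension v TF,
         maximal_tame_subextension v TG &
         exists f : {lrmorphism subvs_of TF -> subvs_of TG}, bijective f]).
Proof.
have [NF dF] := delta_poly_norm F_monic F_deg F_sep.
have nu_gt' : 2 * v (poly_norm n (poly_over_field F) (poly_over_field F)^`()) <
    n%:Z * nu%:Z.
  move: nu_gt; rewrite -dF ltr_pdivrMr ?ltr0z// -!intrM ltr_int.
  by rewrite [n%:Z * _]mulrC.
have fm : poly_over_field F \is monic by rewrite poly_over_field_monic.
have gm : poly_over_field G \is monic by rewrite poly_over_field_monic.
have sf : size (poly_over_field F) = n.+1 by rewrite size_poly_over_field.
have sg : size (poly_over_field G) = n.+1 by rewrite size_poly_over_field.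
have FG' i : (poly_over_field G - poly_over_field F)`_i \in vge v nu%:Z.
  by rewrite coefB !coef_map /= -vge_opp opprB; apply: FG.
have irrFG := irreducible_approximation k_lcompact n_gt0 fm gm
  (poly_over_fieldP F) (poly_over_fieldP G) sf sg FG' NF nu_gt'.
split; first by rewrite !irreducible_elt_poly.
move=> /irreducible_elt_poly-/(_ F_monic) Firr.
pose hF : monic_irreducible_poly (poly_over_field F) := (Firr, fm).
pose hG : monic_irreducible_poly (poly_over_field G) := (irrFG.1 Firr, gm).
have [b gb b_full] := approximation_generates k_lcompact n_gt0 fm gm
  (poly_over_fieldP F) (poly_over_fieldP G) sf FG' NF nu_gt' hF.
have [TF [TG TFG]] := maximal_tame_iso v (stem_map_bij hG gb b_full).
by exists hF, hG, TF, TG.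
Qed.
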